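(* Let $\alpha\in\mathbb R\setminus\mathbb Q$, $\beta\in\mathbb R$, and let $f:\mathbb T^2\to\mathbb T^2$ be the uniquely ergodic skew-shift $f(x,y)=(x+\alpha,\,y+x+\beta)$. Assume that $\Phi\in\mathcal M_f$ (so that $\phi$ is not a measurable coboundary for $f$). Then for each $C>1$, $$\lim_{n\to\infty}\mathrm{Leb}\left(\{(x,y)\in\mathbb T^2:\ |\phi_n(x,y)|<C\}\right)=0 .$$
   Context: $\mathbb T=\mathbb R/\mathbb Z$, $\mathbb T^2=\mathbb R^2/\mathbb Z^2$, and $\mathrm{Leb}$ is Lebesgue measure on $\mathbb T^2$. For a (real) function $\Phi$ on $\mathbb T^2$ put $\phi^\perp(x):=\int_{\mathbb T}\Phi(x,y)\,dy$ and $\phi(x,y):=\Phi(x,y)-\phi^\perp(x)$. The Birkhoff sums are $\phi_n:=\sum_{k=0}^{n-1}\phi\circ f^k$. Class $\mathcal R$: for an integer $d\ge1$ let $\mathcal P_d$ be the space of all continuous functions $\Phi$ on $\mathbb T^2$ such that for each $x\in\mathbb T$ the function $\Phi(x,\cdot)$ is a trigonometric polynomial of degree at most $d$ on $\mathbb T$, and $\mathcal P:=\bigcup_{d\ge1}\mathcal P_d$. Then $\Phi\in\mathcal R$ if and only if $\Phi\in\mathcal P$ and $\phi^\perp$ is a trigonometric polynomial on $\mathbb T$. A function $\phi$ on $\mathbb T^2$ is a measurable coboundary for $f$ if there is a measurable $u:\mathbb T^2\to\mathbb R$ with $\phi=u\circ f-u$ (almost everywhere). Class $\mathcal M_f$: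 $\Phi\in\mathcal M_f$ if and only if $\Phi\in\mathcal R$ and $\phi$ is not a measurable coboundary for $f$. *)

(* Defs.v *)
From HB Require Import structures.
From mathcomp Require Import all_boot all_order all_algebra.
From mathcomp Require Import all_classical all_reals all_analysis.

Set Implicit Arguments.
Unset Strict Implicit.
Unset Printing Implicit Defensive.

Import Order.TTheory GRing.Theory Num.Theory.
Import numFieldNormedType.Exports.

Local Open Scope classical_set_scope.
Local Open Scope ring_scope.

(* Functions on the torus T^2 = R^2/Z^2 are represented by their lifts, the
   functions on R * R that are 1-periodic in each coordinate, and self-maps of
   T^2 by lifts to R * R.  Continuity on T^2 is continuity of the lift, and
   measures and integrals are taken over the fundamental domain [0, 1[^2. *)

Section Torus.
Context {R : realType}.
Local Notation T2 := (measurableTypeR R * measurableTypeR R)%type.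
Implicit Types (Phi phi u : R * R -> R) (f : R * R -> R * R).

Definition periodic2 Phi :=
  forall x y, Phi (x + 1, y) = Phi (x, y) /\ Phi (x, y + 1) = Phi (x, y).

Definition unit_square : set T2 := `[0, 1[%classic `*` `[0, 1[%classic.

Lemma measurable_unit_square : measurable unit_square.
Proof. exact: measurableX. Qed.

Definition Leb : {measure set T2 -> \bar R} :=
  mrestr (@lebesgue_measure R \x @lebesgue_measure R)%E measurable_unit_square.

(* Real trigonometric polynomials on R/Z of degree at most d; in terms of
   exponentials, the sums of c_k e^(2 i pi k t) over |k| <= d with
   c_(-k) conjugate to c_k. *)
Definition trig_poly (d : nat) (g : R -> R) :=
  exists a b : nat -> R, forall t,
    g t = a 0 + \sum_(1 <= k < d.+1)
      (a k * cos (2 * pi * k%:R * t) + b k * sin (2 * pi * k%:R * t)).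

Definition vmean Phi (x : R) : R :=
  \int[@lebesgue_measure R]_(y in `[0, 1[) Phi (x, y).

Definition vosc Phi (z : R * R) : R := Phi z - vmean Phi z.1.

Definition class_Pd (d : nat) Phi :=
  [/\ periodic2 Phi, continuous Phi &
      forall x, trig_poly d (fun y => Phi (x, y))].

Definition class_P Phi := exists2 d : nat, (1 <= d)%N & class_Pd d Phi.

Definition class_R Phi :=
  class_P Phi /\ exists d : nat, trig_poly d (vmean Phi).

(* Up to modification on a null set, Borel and Lebesgue measurable transfer
   functions u are the same, so Borel measurability is no restriction. *)
Definition measurable_coboundary f phi :=
  exists u, [/\ periodic2 u, measurable_fun [set: T2] u &
                {ae Leb, forall z, phi z = u (f z) - u z}].

Definition class_M f Phi :=
  class_R Phi /\ ~ measurable_coboundary f (vosc Phi).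

Definition skew_shift (alpha beta : R) (z : R * R) : R * R :=
  (z.1 + alpha, z.2 + z.1 + beta).

Definition birkhoff_sum f phi (n : nat) (z : R * R) : R :=
  \sum_(0 <= k < n) phi (iter k f z).

End Torus.

(* Main.v *)
(* Suppose Leb{|phi_n| < C} > e for infinitely many n.  A second-moment estimate
   along m |-> phi_n o f^m shows that, for every M and on average over pairs
   m, k < M with r = |m - k|, the function phi_n o f^r - phi_n = phi_r o f^n - phi_r
   is bounded by 2C with probability at least e^2.  Since
   f^n(x, y) = (x + n alpha, y + n x + c_n), the fibre coordinate of f^n z becomes
   independent of z as n grows with r fixed; and a trigonometric polynomial of
   bounded degree and zero mean that is large somewhere stays within 2C of a given
   constant only on a small set.  Hence phi_r is bounded by some A with positive
   probability, on average over r.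

   It follows that phi is a coboundary.  Let B(z) be the set of t such that
   t + phi_n(z) visits a neighbourhood of 0 with upper frequency greater than l.
   Then B(f z) = B(z) + phi(z), B(z) is nonempty with positive probability, and a
   maximal inequality for (z, t) |-> (f z, t + phi(z)) on T^2 x R shows that B(z)
   is bounded for almost every z.  By ergodicity of f, u(z) = sup B(z) is finite
   almost everywhere, and phi = u o f - u. *)
Require Import Defs.
From HB Require Import structures.
From mathcomp Require Import all_boot all_order all_algebra.
From mathcomp Require Import all_classical all_reals all_analysis.
From mathcomp Require Import measurable_realfun ring lra.
Import Order.TTheory GRing.Theory Num.Theory.
Import numFieldNormedType.Exports.
Local Open Scope classical_set_scope.
Local Open Scope ring_scope.

Set Implicit Arguments.
Unset Strict Implicit.
Unset Printing Implicit Defensive.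

(** * Translation invariance and Fubini on the torus *)

(** The order of choices is the main constraint: the threshold [A] may depend on the fibre degree
    [d], on [e] and on [C], but not on [r], while [n] is taken large only after [M] is fixed. This
    is possible because on each vertical fibre every Birkhoff sum is a zero-mean trigonometric
    polynomial of the same degree, and a Remez-type bound that sees the polynomial only through its
    degree serves all [r] at once.

    The outcome is that [phi_r] is bounded with a probability bounded below, and only on average
    over [r]; this is weaker than tightness, the usual criterion for a coboundary. The substitute is
    that [(z, t) |-> (f z, t + phi(z))] preserves an infinite measure: the points that visit a
    bounded strip with frequency above [l] form a set of measure at most a constant times [1 / l],
    so almost every fibre carries a finite length of them. Since the visit counts are Lipschitz in
    [t], each recurrent height comes with an interval of fixed length of nearly recurrent ones, and
    finite length becomes boundedness. *)

Local Notation I01 := (`[0, 1[%classic).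

(** By uniqueness of Lebesgue measure, comparing the values on half-open intervals suffices. *)
Lemma lebesgue_measure_shift (R : realType) (s : R) (A : set (measurableTypeR R)) :
  measurable A ->
  pushforward (@lebesgue_measure R) (fun x : measurableTypeR R => x + s) A
  = lebesgue_measure A.
Proof.
have ms : measurable_fun [set: measurableTypeR R]
  ((fun x => x + s) : measurableTypeR R -> measurableTypeR R).
  exact: measurable_funD.
pose f : {mfun measurableTypeR R >-> measurableTypeR R} :=
  HB.pack (fun x : measurableTypeR R => x + s)
    (isMeasurableFun.Build _ _ _ _ _ ms).
move=> mA; apply/esym.
apply: (@lebesgue_measure_unique R (pushforward lebesgue_measure f)) => //.
move=> _ [[a b]] _ <-.
transitivity (lebesgue_measure `](a - s), (b - s)]%classic).
  rewrite !lebesgue_measure_itv/= !lte_fin ltrD2r; case: ifP => // _.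
  by rewrite -!EFinD; congr (_%:E); ring.
congr (lebesgue_measure _); apply/seteqP; split => x /=;
  by rewrite !in_itv/= ltrBlDr lerBrDr.
Qed.

Lemma ge0_integral_shift (R : realType) (s : R) (D : set (measurableTypeR R))
    (g : R -> \bar R) :
  measurable D -> measurable_fun [set: measurableTypeR R] g -> (forall x, 0 <= g x)%E ->
  (\int[@lebesgue_measure R]_(x in (fun x => (x + s)%R) @^-1` D) g (x + s)%R =
  \int[@lebesgue_measure R]_(x in D) g x)%E.
Proof.
move=> mD mg g0.
have ms : measurable_fun [set: measurableTypeR R]
  ((fun x => x + s) : measurableTypeR R -> measurableTypeR R).
  exact: measurable_funD.
have := @ge0_integral_pushforward _ _ _ _ _ _ ms (@lebesgue_measure R) D g mD
  (measurable_funS measurableT (@subsetT _ _) mg) (fun x _ => g0 x).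
move=> <-; apply: eq_measure_integral => A mA _.
exact: lebesgue_measure_shift.
Qed.

Lemma periodicZ (R : realType) (T : Type) (g : R -> T) (m : int) :
  (forall x, g (x + 1) = g x) -> forall x, g (x + m%:~R) = g x.
Proof.
move=> g1; have gN n x : g (x + n%:R) = g x.
  by elim: n x => [|n IH] x; rewrite ?addr0// -natr1 addrA g1.
case: m => n x; first by rewrite -pmulrn gN.
by rewrite NegzE mulrNz -pmulrn -[in RHS](subrK n.+1%:R x) gN.
Qed.

(** After reduction of [s] modulo 1, the window [[s, 1 + s[] differs from [[0, 1[] by trading [[0,
    s[] for its translate [[1, 1 + s[]. *)
Lemma ge0_integral_period (R : realType) (s : R) (g : R -> \bar R) :
  measurable_fun [set: measurableTypeR R] g -> (forall x, 0 <= g x)%E ->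
  (forall x, g (x + 1) = g x) ->
  (\int[@lebesgue_measure R]_(x in I01) g (x + s)%R =
  \int[@lebesgue_measure R]_(x in I01) g x)%E.
Proof.
move=> mg g0 g1.
have mgD (D : set (measurableTypeR R)) : measurable_fun D g
  by exact: measurable_funS mg.
wlog /andP[s0 s1] : s / 0 <= s < 1.
  move=> H; rewrite -(H (s - (Num.floor s)%:~R)); last first.
    have /andP[h1 h2] := mem_rg1_floor s.
    by rewrite subr_ge0 h1 ltrBlDl.
  apply: eq_integral => x _.
  by rewrite -[in LHS](periodicZ (- Num.floor s) g1) mulrNz addrA.
transitivity (\int[@lebesgue_measure R]_(x in `[s, (1 + s)%R[) g x)%E.
  rewrite -(ge0_integral_shift s (D := `[s, (1 + s)%R[))//.
  rewrite (_ : _ @^-1` _ = I01)//.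
  by apply/seteqP; split => x /=; rewrite !in_itv/= lerDr ltrD2r.
have -> : `[s, 1 + s[%classic = `[s, 1[%classic `|` `[1, 1 + s[%classic :> set R.
  by rewrite -itv_bndbnd_setU// bnd_simp ?lerDl// ltW.
rewrite ge0_integral_setU//; last first.
  apply/disj_set2P/seteqP; split => // x /= [].
  by rewrite !in_itv/= => /andP[_ h] /andP[h2 _]; lra.
have <- : (\int[@lebesgue_measure R]_(x in `[0%R, s[) g x =
    \int[@lebesgue_measure R]_(x in `[1%R, (1 + s)%R[) g x)%E.
  rewrite -(ge0_integral_shift 1 (D := `[1%R, (1 + s)%R[))//.
  rewrite (_ : _ @^-1` _ = `[0, s[%classic); last first.
    by apply/seteqP; split => x /=; rewrite !in_itv/= lerDr (addrC 1) ltrD2r.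
  by apply: eq_integral => x _; rewrite g1.
rewrite addeC -ge0_integral_setU//.
  by rewrite -itv_bndbnd_setU// bnd_simp ltW.
apply/disj_set2P/seteqP; split => // x /= [].
by rewrite !in_itv/= => /andP[_ h] /andP[h2 _]; lra.
Qed.

Section FubiniDom.
Local Open Scope ereal_scope.
Context d1 d2 (X : measurableType d1) (Y : measurableType d2) (R : realType).
Variables (m1 : {sigma_finite_measure set X -> \bar R})
  (m2 : {sigma_finite_measure set Y -> \bar R}) (D1 : set X) (D2 : set Y)
  (g : X * Y -> \bar R).
Hypotheses (mD1 : measurable D1) (mD2 : measurable D2)
  (mg : measurable_fun [set: X * Y] g) (g0 : forall z, 0 <= g z).

Let h := g \_ (D1 `*` D2).

Let mh : measurable_fun [set: X * Y] h.
Proof.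
apply/(measurable_restrictT _ _).1; first exact: measurableX.
exact: measurable_funS mg.
Qed.

Let h0 z : 0 <= h z. Proof. by rewrite /h patchE; case: ifP. Qed.

Let hE1 x : \int[m2]_y h (x, y) = ((fun x => \int[m2]_(y in D2) g (x, y)) \_ D1) x.
Proof.
rewrite patchE; case: ifPn => [xD|xD].
  rewrite [RHS]integral_mkcond; apply: eq_integral => y _.
  by rewrite /h !patchE in_setX xD.
by rewrite integral0_eq// => y _; rewrite /h patchE in_setX (negbTE xD).
Qed.

Let hE2 y : \int[m1]_x h (x, y) = ((fun y => \int[m1]_(x in D1) g (x, y)) \_ D2) y.
Proof.
rewrite patchE; case: ifPn => [xD|xD].
  rewrite [RHS]integral_mkcond; apply: eq_integral => x _.
  by rewrite /h !patchE in_setX xD andbT.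
by rewrite integral0_eq// => x _; rewrite /h patchE in_setX (negbTE xD) andbF.
Qed.

Lemma ge0_fubini1_dom :
  \int[m1 \x m2]_(z in D1 `*` D2) g z = \int[m1]_(x in D1) \int[m2]_(y in D2) g (x, y).
Proof.
rewrite integral_mkcond fubini_tonelli1// [RHS]integral_mkcond.
by apply: eq_integral => x _; exact: hE1.
Qed.

Lemma ge0_fubini2_dom :
  \int[m1 \x m2]_(z in D1 `*` D2) g z = \int[m2]_(y in D2) \int[m1]_(x in D1) g (x, y).
Proof.
rewrite integral_mkcond fubini_tonelli2// [RHS]integral_mkcond.
by apply: eq_integral => x _; exact: hE2.
Qed.

Lemma ge0_fubini_dom :
  \int[m1]_(x in D1) \int[m2]_(y in D2) g (x, y) =
  \int[m2]_(y in D2) \int[m1]_(x in D1) g (x, y).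
Proof. by rewrite -ge0_fubini1_dom ge0_fubini2_dom. Qed.

End FubiniDom.

Lemma measurable_fun_integral_dom d1 d2 (X : measurableType d1)
    (Y : measurableType d2) (R : realType)
    (m : {sigma_finite_measure set Y -> \bar R}) (D : set Y) (g : X * Y -> \bar R) :
  measurable D -> measurable_fun [set: X * Y] g -> (forall z, 0 <= g z)%E ->
  measurable_fun [set: X] (fun x => \int[m]_(y in D) g (x, y))%E.
Proof.
move=> mD mg g0.
have -> : (fun x => \int[m]_(y in D) g (x, y))%E =
    fubini_F m (g \_ ([set: X] `*` D)).
  apply/funext => x; rewrite /fubini_F [LHS]integral_mkcond.
  by apply: eq_integral => y _; rewrite !patchE in_setX in_setT.
apply: measurable_fun_fubini_tonelli_F; last first.
  by move=> z; rewrite patchE; case: ifP.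
apply/(measurable_restrictT _ _).1; first exact: measurableX.
exact: measurable_funS mg.
Qed.

Section TorusIntegral.
Variable R : realType.
Local Notation T1 := (measurableTypeR R).
Local Notation T2 := (measurableTypeR R * measurableTypeR R)%type.
Local Notation la := (@lebesgue_measure R).
Local Open Scope ereal_scope.
Implicit Types g : R * R -> \bar R.

Lemma Leb_unit_squareC : Leb (~` (@unit_square R)) = 0.
Proof. by rewrite /Leb /= /mrestr setICl measure0. Qed.

Lemma integral_LebE g : measurable_fun [set: T2] g -> (forall z, 0 <= g z) ->
  \int[Leb]_z g z = \int[la \x la]_(z in unit_square) g z.
Proof.
move=> mg g0; have mD := @measurable_unit_square R.
have mC : measurable (~` (@unit_square R)) by exact: measurableC.
have -> := @ge0_negligible_integral _ _ _ (@Leb R) setT _ g mC measurableT mg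
  (fun z _ => g0 z) Leb_unit_squareC.
rewrite setTD setCK; apply: eq_measure_integral => A mA /= /setIidl AD.
by rewrite /mrestr AD.
Qed.

Lemma integral_Leb g : measurable_fun [set: T2] g -> (forall z, 0 <= g z) ->
  \int[Leb]_z g z = \int[la]_(x in I01) \int[la]_(y in I01) g (x, y).
Proof. by move=> mg g0; rewrite integral_LebE// ge0_fubini1_dom. Qed.

Lemma integral_Leb_swap g : measurable_fun [set: T2] g -> (forall z, 0 <= g z) ->
  \int[Leb]_z g z = \int[la]_(y in I01) \int[la]_(x in I01) g (x, y).
Proof. by move=> mg g0; rewrite integral_LebE// ge0_fubini2_dom. Qed.

Lemma lebesgue_I01 : la I01 = 1.
Proof. by rewrite lebesgue_measure_itv/= lte_fin ltr01 oppr0 adde0. Qed.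

Lemma Leb_setT : @Leb R setT = 1.
Proof.
rewrite /Leb/= /mrestr setTI /unit_square product_measure1E//.
by rewrite [X in _ * X]lebesgue_I01 mule1; exact: lebesgue_I01.
Qed.

Lemma measurable_fun_skew (a : R) (h : R -> R) : measurable_fun [set: T1] h ->
  measurable_fun [set: T2] ((fun z => (z.1 + a, z.2 + h z.1)%R) : T2 -> T2).
Proof.
move=> mh; apply/measurable_fun_pair => /=.
  by apply: measurable_funD => //; exact: measurable_fst.
apply: measurable_funD; first exact: measurable_snd.
by apply: measurableT_comp => //; exact: measurable_fst.
Qed.

(** On each vertical fibre the map is a translation by [h x], absorbed by periodicity in [y]; a
    translation in [x] remains. This one form covers the iterates of the skew shift and all
    translations of the torus. *)
Lemma integral_Leb_skew (a : R) (h : R -> R) g :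
  measurable_fun [set: T1] h ->
  measurable_fun [set: T2] g -> (forall z, 0 <= g z) ->
  (forall x y, g (x + 1, y)%R = g (x, y) /\ g (x, y + 1)%R = g (x, y)) ->
  \int[Leb]_z g (z.1 + a, z.2 + h z.1)%R = \int[Leb]_z g z.
Proof.
move=> mh mg g0 gp; rewrite !integral_Leb//; last first.
  exact: (measurableT_comp mg (measurable_fun_skew a mh)).
under eq_integral => x _ do rewrite /= (ge0_integral_period (h x)
  (g := fun y => g (x + a, y)%R) (measurable_fun_pair2 _ mg) (fun _ => g0 _)
  (fun y => (gp _ _).2)).
rewrite (ge0_integral_period a (g := fun x => \int[la]_(y in I01) g (x, y)))//.
- exact: measurable_fun_integral_dom.
- by move=> x; exact: integral_ge0.
- by move=> x; apply: eq_integral => y _; rewrite (gp x y).1.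
Qed.

End TorusIntegral.

(** * Sublevel sets of trigonometric polynomials *)

Section HomTrig.
Variable R : realType.
Implicit Types (P Q : R -> R) (m : nat).
Local Notation la := (@lebesgue_measure R).

(* Homogeneous polynomials of degree m in cos (pi t) and sin (pi t); a trigonometric
   polynomial of degree d on R/Z is of class 2d.  By homogeneity P (t + s) - P s * cos (pi t) ^ m
   is sin (pi t) times a polynomial of degree m - 1, which allows induction on m. *)
Fixpoint homtrig m P : Prop :=
  if m is m'.+1 then
    exists P1 P2, [/\ homtrig m' P1, homtrig m' P2 &
      forall t, P t = cos (pi * t) * P1 t + sin (pi * t) * P2 t]
  else exists c, forall t, P t = c.

Lemma homtrig_lin m a b P Q : homtrig m P -> homtrig m Q ->
  homtrig m (fun t => a * P t + b * Q t).
Proof.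
elim: m P Q => [|m IH] P Q /=.
  by move=> [c Pc] [e Qe]; exists (a * c + b * e) => t; rewrite Pc Qe.
move=> [P1 [P2 [hP1 hP2 PE]]] [Q1 [Q2 [hQ1 hQ2 QE]]].
exists (fun t => a * P1 t + b * Q1 t), (fun t => a * P2 t + b * Q2 t).
by split; [exact: IH|exact: IH|move=> t; rewrite PE QE; ring].
Qed.

Lemma homtrig_ext m P Q : P =1 Q -> homtrig m P -> homtrig m Q.
Proof. by move=> /funext ->. Qed.

Lemma homtrig0 m : homtrig m (fun=> 0).
Proof.
elim: m => [|m IH]; first by exists 0.
by exists (fun=> 0), (fun=> 0); split=> // t; ring.
Qed.

Lemma homtrigD m P Q : homtrig m P -> homtrig m Q ->
  homtrig m (fun t => P t + Q t).
Proof.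
move=> hP hQ; apply: homtrig_ext (homtrig_lin 1 1 hP hQ) => t.
by rewrite !mul1r.
Qed.

Lemma homtrig_cosM m P : homtrig m P -> homtrig m.+1 (fun t => cos (pi * t) * P t).
Proof.
by move=> hP; exists P, (fun=> 0); split=> //; [exact: homtrig0|move=> t; ring].
Qed.

Lemma homtrig_sinM m P : homtrig m P -> homtrig m.+1 (fun t => sin (pi * t) * P t).
Proof.
by move=> hP; exists (fun=> 0), P; split=> //; [exact: homtrig0|move=> t; ring].
Qed.

(** Multiply by cos^2 + sin^2 = 1; the degree can be raised only by even amounts. *)
Lemma homtrigS2 m P : homtrig m P -> homtrig m.+2 P.
Proof.
move=> hP.
have := homtrigD (homtrig_cosM (homtrig_cosM hP)) (homtrig_sinM (homtrig_sinM hP)).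
by apply: homtrig_ext => t; rewrite !mulrA -!expr2 -mulrDl cos2Dsin2 mul1r.
Qed.

Lemma homtrig_widen m k P : homtrig m P -> homtrig (m + k.*2) P.
Proof.
move=> hP; elim: k => [|k IH]; first by rewrite addn0.
by rewrite doubleS !addnS; exact: homtrigS2.
Qed.

Lemma homtrig_shift m P s : homtrig m P -> homtrig m (fun t => P (t + s)).
Proof.
elim: m P => [|m IH] P /=; first by move=> [c Pc]; exists c.
move=> [P1 [P2 [/IH hP1 /IH hP2 PE]]].
exists (fun t => cos (pi * s) * P1 (t + s) + sin (pi * s) * P2 (t + s)).
exists (fun t => (- sin (pi * s)) * P1 (t + s) + cos (pi * s) * P2 (t + s)).
split; [exact: homtrig_lin|exact: homtrig_lin|move=> t].
by rewrite PE mulrDr sinD cosD; ring.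
Qed.

Lemma homtrig_cos_sin m :
  homtrig m (fun t => cos (pi * (m%:R * t))) /\ homtrig m (fun t => sin (pi * (m%:R * t))).
Proof.
elim: m => [|m [hc hs]].
  by split; [exists 1|exists 0] => t; rewrite mul0r mulr0 ?cos0 ?sin0.
have E t : pi * (m.+1%:R * t) = pi * t + pi * (m%:R * t) :> R.
  by rewrite -natr1; ring.
split.
  exists (fun t => cos (pi * (m%:R * t))), (fun t => (-1) * sin (pi * (m%:R * t)) + 0 * 0).
  split=> //; first exact: homtrig_lin (homtrig0 m).
  by move=> t; rewrite E cosD; ring.
exists (fun t => sin (pi * (m%:R * t))), (fun t => cos (pi * (m%:R * t))).
by split=> // t; rewrite E sinD; ring.
Qed.

Lemma trig_poly_homtrig d P : trig_poly d P -> homtrig d.*2 P.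
Proof.
move=> [a [b PE]].
suff : homtrig d.*2 (fun t => a 0 + \sum_(1 <= k < d.+1)
      (a k * cos (2 * pi * k%:R * t) + b k * sin (2 * pi * k%:R * t))).
  by apply: homtrig_ext => t; rewrite PE.
elim: d {P PE} => [|d IH].
  by exists (a 0) => t; rewrite big_geq// addr0.
have : homtrig d.+1.*2 (fun t => a d.+1 * cos (pi * (d.+1.*2%:R * t)) +
    b d.+1 * sin (pi * (d.+1.*2%:R * t))).
  by apply: homtrig_lin; have [] := homtrig_cos_sin d.+1.*2.
move/(homtrigD (homtrigS2 IH)); apply: homtrig_ext => t.
rewrite [in RHS]big_nat_recr//= addrA -(mul2n d.+1) natrM.
by rewrite (_ : pi * (2 * d.+1%:R * t) = 2 * pi * d.+1%:R * t) ?addrA//; ring.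
Qed.

(** Every monomial of degree [m.+1] except the pure power of the cosine contains a factor
    [sin (pi * t)]. *)
Lemma homtrig_lead m P : homtrig m.+1 P ->
  exists a Q, homtrig m Q /\
    forall t, P t = a * cos (pi * t) ^+ m.+1 + sin (pi * t) * Q t.
Proof.
elim: m P => [|m IH] P [P1 [P2 [hP1 hP2 PE]]].
  case: hP1 => a P1a; exists a, P2; split=> // t.
  by rewrite PE P1a expr1; ring.
have [a [Q1 [hQ1 P1E]]] := IH _ hP1.
exists a, (fun t => cos (pi * t) * Q1 t + P2 t); split.
  by apply: homtrigD => //; exact: homtrig_cosM.
by move=> t; rewrite PE P1E (exprS _ m.+1); ring.
Qed.

Lemma homtrig_continuous m P : homtrig m P -> continuous P.
Proof.
elim: m P => [|m IH] P /=.
  by move=> [c Pc]; rewrite (_ : P = cst c); [move=> x; exact: cvg_cst|exact: funext].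
move=> [P1 [P2 [/IH cP1 /IH cP2 PE]]].
have -> : P = (fun t => cos (pi * t) * P1 t + sin (pi * t) * P2 t) by exact: funext.
have pic : continuous (fun t : R => pi * t) by exact: mulrl_continuous.
move=> x; apply: cvgD; apply: cvgM => //; try exact: cP1; try exact: cP2.
  by apply: continuous_comp; [exact: pic|exact: continuous_cos].
by apply: continuous_comp; [exact: pic|exact: continuous_sin].
Qed.

(** Both [cos (pi * t)] and [sin (pi * t)] change sign under [t + 1], so for odd [m] only the
    absolute value is 1-periodic. *)
Lemma homtrig_normD1 m P t : homtrig m P -> `|P (t + 1)| = `|P t|.
Proof.
suff H : homtrig m P -> P (t + 1) = (-1) ^+ m * P t.
  by move=> /H ->; rewrite normrM normrX normrN normr1 expr1n mul1r.
elim: m P => [|m IH] P /=; first by move=> [c Pc]; rewrite !Pc mul1r.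
move=> [P1 [P2 [/IH hP1 /IH hP2 PE]]].
by rewrite !PE hP1 hP2 mulrDr mulr1 (sinDpi (pi * t)) (cosDpi (pi * t)) exprS; ring.
Qed.

Lemma lebesgue_period (s : R) (S : set R) :
  measurable (S : set (measurableTypeR R)) -> (forall x, S (x + 1) = S x) ->
  la (I01 `&` [set x | S (x + s)]) = la (I01 `&` S).
Proof.
move=> mS Sp.
have mSs : measurable ([set x | S (x + s)] : set (measurableTypeR R)).
  have : measurable_fun [set: measurableTypeR R]
    ((fun x => x + s) : measurableTypeR R -> measurableTypeR R).
    exact: measurable_funD.
  by move=> /(_ measurableT _ mS); rewrite setTI.
rewrite setIC -[LHS](integral_indic la (D := I01) _ mSs)//.
rewrite setIC -[RHS](integral_indic la (D := I01) _ mS)//.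
rewrite -(ge0_integral_period s (g := fun x => (\1_S x)%:E))//.
- by apply/measurable_EFinP; exact: measurable_indic.
- by move=> x; rewrite !indicE /in_mem/= /in_set/= Sp.
Qed.

(** As sin x = cos |x - pi/2| and the cosine decreases on [0, pi], it is enough that [t] is no
    farther from 1/2 than [e]. *)
Lemma sin_pi_ge (e t : R) : 0 <= e <= 2^-1 -> e <= t <= 1 - e ->
  sin (pi * e) <= sin (pi * t).
Proof.
move=> /andP[e0 e1] /andP[h1 h2].
have pi0 := pi_gt0 R.
have E (x : R) : sin x = cos `|x - pi / 2| by rewrite cos_norm cosBpihalf.
rewrite !E; rewrite le_eqVlt; have [->|ne] := eqVneq (`|pi * e - pi / 2|) (`|pi * t - pi/2|).
  by rewrite eqxx.
apply/orP; right.
have F (x : R) : pi * x - pi / 2 = pi * (x - 2^-1) by ring.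
have B (x : R) : 0 <= x <= 1 -> `|pi * x - pi/2| \in `[0, pi].
  move=> /andP[x0 x1]; rewrite in_itv/= normr_ge0/= F normrM gtr0_norm//.
  by rewrite ler_piMr ?(ltW pi0)// ler_norml; apply/andP; split; lra.
rewrite ltr_cos ?B//; [|by apply/andP; split; lra|by apply/andP; split; lra].
rewrite lt_neqAle eq_sym ne/= !F !normrM (gtr0_norm pi0) (ler_pM2l pi0).
rewrite (ler0_norm (x := e - _)) ?ler_norml; last by lra.
by apply/andP; split; lra.
Qed.

Lemma measurable_sublevel m P (C : R) : homtrig m P ->
  measurable ([set t | `|P t| < C] : set (measurableTypeR R)).
Proof.
move=> hP; have mP : measurable_fun [set: measurableTypeR R] (fun t => `|P t|).
  apply: measurableT_comp => //.
  apply: (@continuous_measurable_fun R P).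
  exact: homtrig_continuous hP.
have := measurable_fun_ltr mP (measurable_cst C).
move=> /(_ measurableT [set true]); rewrite setTI; apply.
by [].
Qed.

(** A Remez-type inequality. After translation by a point [s0] of the sublevel set, the leading
    coefficient is [P s0], hence less than [C] in absolute value. So [sin (pi * t) * Q t] is below
    [2 * C] on the translated set, and away from the zeros of the sine [Q] itself is bounded on a
    set of measure at least [eps / 2], to which the induction hypothesis applies. *)
Lemma homtrig_remez m (eps C : R) : 0 < eps -> exists A : R, forall P, homtrig m P ->
  (eps%:E <= la (I01 `&` [set t | (`|P t| < C)%R]))%E -> forall t, `|P t| <= A.
Proof.
have nonempty (D : set R) (e : R) : 0 < e -> (e%:E <= la D)%E -> exists t, D t.
  move=> e0 eD; apply/set0P/eqP => D0; move: eD.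
  by rewrite D0 measure0 lee_fin leNgt e0.
elim: m eps C => [|m IH] eps C eps0.
  exists C => P [c Pc] /(nonempty _ _ eps0)[s [_ /=]].
  by rewrite Pc => cC t; rewrite Pc ltW.
(* The two end intervals of length [e] discarded in [Z] cost at most [eps / 2]; [sin_pi_ge] requires
   [e <= 1/2]. *)
pose e := Num.min (eps / 4) 2^-1.
have e0 : 0 < e by rewrite lt_min; apply/andP; split; lra.
have [e1 e2] : e <= eps / 4 /\ e <= 2^-1 by rewrite !ge_min !lexx orbT.
pose eta := sin (pi * e).
have eta0 : 0 < eta.
  have pi0 := pi_gt0 R.
  apply: sin_gt0_pi; rewrite mulr_gt0//= -[ltRHS]mulr1 (ltr_pM2l pi0); lra.
have eps2 : 0 < eps / 2 by lra.
have [A HA] := IH (eps / 2) (2 * C / eta) eps2.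
exists (C + A) => P hP meas.
have [s0 [_ /= s0C]] := nonempty _ _ eps0 meas.
have hP' := homtrig_shift s0 hP.
have [a [Q [hQ PE]]] := homtrig_lead hP'.
have aE : a = P s0 by have := PE 0; rewrite add0r mulr0 cos0 sin0 expr1n mulr1 mul0r addr0.
pose S := [set t | `|P (t + s0)| < C].
pose Z := `[0, e[%classic `|` `[1 - e, 1[%classic : set R.
have mS : measurable (S : set (measurableTypeR R)) by exact: measurable_sublevel hP'.
have mQ : measurable ([set t | `|Q t| < 2 * C / eta] : set (measurableTypeR R)).
  exact: measurable_sublevel hQ.
have mI (i : interval R) : measurable ([set` i] : set (measurableTypeR R)).
  exact: measurable_itv.
have aC : `|a| < C by rewrite aE.
have cosn t : `|a * cos (pi * t) ^+ m.+1| <= `|a|.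
  rewrite normrM normrX ler_piMr//.
  by apply: exprn_ile1 => //; exact: cos_max.
have sub : I01 `&` S `<=` (I01 `&` [set t | `|Q t| < 2 * C / eta]) `|` Z.
  move=> t [/= + tS]; rewrite in_itv/= => /andP[t0 t1].
  have [te|te] := ltP t e; first by right; left; rewrite /= in_itv/= t0.
  have [te'|te'] := leP (1 - e) t; first by right; right; rewrite /= in_itv/= te'.
  left; split; rewrite /= ?in_itv/= ?t0//.
  have st : eta <= sin (pi * t) by apply: sin_pi_ge; apply/andP; split; lra.
  have : `|sin (pi * t) * Q t| < 2 * C.
    rewrite (_ : sin _ * _ = P (t + s0) - a * cos (pi * t) ^+ m.+1); last first.
      by rewrite PE; ring.
    apply: le_lt_trans (ler_normB _ _) _.
    by have := cosn t; rewrite /S/= in tS; lra.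
  rewrite normrM ltr_pdivlMr// mulrC; apply: le_lt_trans.
  by rewrite ler_wpM2l// (le_trans st)// ler_norm.
have measS : (eps%:E <= la (I01 `&` S))%E.
  rewrite (lebesgue_period s0 (measurable_sublevel C hP))// => x.
  by rewrite /= (homtrig_normD1 _ hP).
have mZ : (la Z <= (eps / 2)%:E)%E.
  apply: (@le_trans _ _ (la `[0%R, e[ + la `[(1 - e)%R, 1%R[)%E).
    exact: measureU2.
  rewrite !lebesgue_measure_itv/= !lte_fin e0 ltrBlDr ltrDl e0.
  by rewrite -!EFinD lee_fin; lra.
have Qbig : ((eps / 2)%:E <= la (I01 `&` [set t | (`|Q t| < 2 * C / eta)%R]))%E.
  have mIQ := measurableI _ _ (mI `[0, 1[) mQ.
  have mZ' : measurable (Z : set (measurableTypeR R)) by exact: measurableU.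
  have := le_trans measS (le_measure la _ _ sub).
  rewrite !inE => /(_ (measurableI _ _ (mI _) mS) (measurableU _ _ mIQ mZ')) h.
  have := le_trans h (le_trans (measureU2 _ mIQ mZ') (leeD2l _ mZ)).
  rewrite -leeBlDr//.
  by apply: le_trans; rewrite -EFinB lee_fin; lra.
move=> t; have := PE (t - s0); rewrite subrK => ->.
apply: le_trans (ler_normD _ _) _; apply: lerD.
  by apply: le_trans (cosn _) _; exact: ltW.
rewrite normrM; apply: le_trans (HA _ hQ Qbig (t - s0)).
by rewrite ler_piMl// sin_max.
Qed.

End HomTrig.

(** * Continuous functions on the torus *)

Section Continuity.
Variable R : realType.
Implicit Types (phi psi : R * R -> R).
Local Notation T1 := (measurableTypeR R).
Local Notation T2 := (measurableTypeR R * measurableTypeR R)%type.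

Lemma continuous_pairP phi : continuous phi -> forall z (e : R), 0 < e ->
  exists2 d : R, 0 < d &
    forall w, `|w.1 - z.1| < d -> `|w.2 - z.2| < d -> `|phi w - phi z| < e.
Proof.
move=> cphi z e e0.
have /cvgrPdist_lt/(_ e e0) := cphi z.
rewrite -filter_from_ballE => -[d /= d0 H]; exists d => // w w1 w2.
rewrite distrC; apply: H; split => /=; rewrite -ball_normE/= distrC//.
Qed.

(** Measurability refers to the product sigma-algebra, so the open preimage is written as a
    countable union of squares with rational centres contained in it. *)
Lemma continuous_measurable_pair phi : continuous phi ->
  measurable_fun [set: T2] phi.
Proof.
move=> cphi; apply: measurability (RGenOInfty.measurableE R) _ => /= _ [_ [a ->] <-].
rewrite setTI.
pose F (q : rat * rat * nat) : set T2 :=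
  let D := (ball (ratr q.1.1 : R) q.2.+1%:R^-1 : set R) `*`
           (ball (ratr q.1.2 : R) q.2.+1%:R^-1 : set R) in
  if `[< D `<=` phi @^-1` `]a, +oo[ >] then D else set0.
have -> : phi @^-1` `]a, +oo[ = \bigcup_q F q.
  apply/seteqP; split => [z /= | z [q _]]; last first.
    by rewrite /F; case: asboolP => // + h; exact.
  rewrite in_itv/= andbT => az.
  have e0 : 0 < phi z - a by rewrite subr_gt0.
  have [d d0 dP] := continuous_pairP cphi z e0.
  have [k kd] : exists k : nat, k.+1%:R^-1 < d / 2.
    have d2 : 0 < d / 2 by lra.
    have [k _ hk] := near_infty_natSinv_lt (PosNum d2).
    by exists k; exact: (hk k (leqnn k)).
  have [e1 e1E] : exists e1 : R, e1 = k.+1%:R^-1 by eexists.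
  have k0 : 0 < e1 by rewrite e1E.
  rewrite -e1E in kd.
  have rat_near (x : R) : exists q : rat, `|x - ratr q| < e1.
    have [q] := @rat_in_itvoo R (x - e1) (x + e1) ltac:(lra).
    by rewrite in_itv/= => /andP[h1 h2]; exists q; rewrite ltr_norml; apply/andP; split; lra.
  have [q1 hq1] := rat_near z.1; have [q2 hq2] := rat_near z.2.
  exists (q1, q2, k) => //; rewrite /F/= -e1E asboolT.
    by split => /=; rewrite -ball_normE/= distrC.
  move=> w [/=]; rewrite -ball_normE/= => w1 w2.
  rewrite in_itv/= andbT.
  have : `|phi w - phi z| < phi z - a.
    apply: dP.
      have := ler_distD (ratr q1) w.1 z.1; rewrite (distrC (ratr q1) z.1) (distrC w.1 (ratr q1)); lra.
    have := ler_distD (ratr q2) w.2 z.2; rewrite (distrC (ratr q2) z.2) (distrC w.2 (ratr q2)); lra.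
  by rewrite ltr_norml => /andP[]; lra.
apply: countable_bigcupT_measurable => //.
move=> q; rewrite /F; case: asboolP => // _.
by apply: measurableX; exact: measurable_ball.
Qed.

Lemma periodic2Z phi (m k : int) x y : periodic2 phi ->
  phi (x + m%:~R, y + k%:~R) = phi (x, y).
Proof.
move=> pphi; rewrite (periodicZ (g := fun x => phi (x, _))) => [|t].
  rewrite (periodicZ (g := fun y => phi (_, y))) => [//|t].
  by rewrite (pphi _ t).2.
by rewrite (pphi t _).1.
Qed.

(** Compactness of [0, 1]^2 makes the modulus uniform over base points in the square, and
    periodicity moves every base point there; the displaced point may leave the square. *)
Lemma unif_continuous_fst phi : continuous phi -> periodic2 phi ->
  forall e : R, 0 < e -> exists2 d : R, 0 < d &
    forall x y s, `|s| < d -> `|phi (x + s, y) - phi (x, y)| < e.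
Proof.
move=> cphi pphi e e0.
have cK : compact (`[0, 1] `*` `[0, 1] : set (R * R)).
  by apply: compact_setX; exact: segment_compact.
have /compact_near_coveringP := cK.
move=> /(_ R (nbhs (0 : R)) (fun s z => `|phi (z.1 + s, z.2) - phi z| < e) _).
case.
  move=> z _.
  have e2 : 0 < e / 2 by lra.
  have [d d0 dP] := continuous_pairP cphi z e2.
  have d2 : 0 < d / 2 by lra.
  exists (ball z (d / 2), ball (0 : R) (d / 2)).
    by split; exact: nbhsx_ballx.
  move=> [w s] [[/= w1 w2] s0]; move: w1 w2 s0; rewrite -!ball_normE/= sub0r normrN.
  rewrite (distrC z.1) (distrC z.2) => w1 w2 s0.
  have h1 : `|phi w - phi z| < e / 2 by apply: dP; lra.
  have h2 : `|phi (w.1 + s, w.2) - phi z| < e / 2.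
    apply: dP => /=; last by lra.
    by have := ler_normD (w.1 - z.1) s; rewrite addrAC; lra.
  have := ler_distD (phi z) (phi (w.1 + s, w.2)) (phi w).
  by rewrite (distrC (phi z) (phi w)); lra.
move=> d /= d0 dP; exists d => // x y s sd.
have fl (t : R) : 0 <= t - (Num.floor t)%:~R <= 1.
  have /andP[h1 h2] := mem_rg1_floor t.
  by rewrite subr_ge0 h1/= lerBlDl ltW.
have := dP s _ (x - (Num.floor x)%:~R, y - (Num.floor y)%:~R).
rewrite /= sub0r normrN => /(_ sd).
rewrite -!mulrNz addrAC !periodic2Z//; apply.
by split => /=; rewrite in_itv/= mulrNz fl.
Qed.

End Continuity.

(** * Zero-mean trigonometric polynomials near a constant *)

Section Spread.
Variable R : realType.
Implicit Types (P Q : R -> R).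
Local Notation la := (@lebesgue_measure R).

Definition zero_mean P := la.-integrable I01 (EFin \o P) /\
  (\int[la]_(y in I01) (P y)%:E = 0)%E.

Lemma homtrig_bounded m P : homtrig m P -> exists K : R, forall t, `|P t| <= K.
Proof.
elim: m P => [|m IH] P /=; first by move=> [c Pc]; exists `|c| => t; rewrite Pc.
move=> [P1 [P2 [/IH[K1 hK1] /IH[K2 hK2] PE]]]; exists (K1 + K2) => t; rewrite PE.
apply: le_trans (ler_normD _ _) _; rewrite !normrM.
by apply: lerD; apply: le_trans (ler_piMl _ _) _; rewrite ?cos_max ?sin_max.
Qed.

Lemma integrable_homtrig m P : homtrig m P -> la.-integrable I01 (EFin \o P).
Proof.
move=> hP; apply: measurable_bounded_integrable => //.
- by rewrite [ltLHS]lebesgue_I01 ltry.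
- apply: measurable_funTS; apply: (@continuous_measurable_fun R P).
  exact: homtrig_continuous hP.
- have [K hK] := homtrig_bounded hP.
  exists K; split; first exact: num_real.
  by move=> M KM t _ /=; apply: le_trans (hK t) (ltW KM).
Qed.

Lemma zero_meanD P Q : zero_mean P -> zero_mean Q -> zero_mean (fun t => P t + Q t).
Proof.
move=> [iP zP] [iQ zQ]; split.
  by apply: (integrableD _ iP iQ).
under eq_integral do rewrite EFinD.
by rewrite integralD//; rewrite zP zQ adde0.
Qed.

Lemma zero_mean_shift m P s : homtrig m P -> (forall t, P (t + 1) = P t) ->
  zero_mean P -> zero_mean (fun t => P (t + s)).
Proof.
move=> hP P1 [iP zP]; split; first exact: integrable_homtrig (homtrig_shift s hP).
(* Adding the bound [K] makes the integrand nonnegative, so that [ge0_integral_period] applies; the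
   constant cancels at the end. *)
have [K hK] := homtrig_bounded hP.
have iK : la.-integrable I01 (EFin \o cst K).
  by apply: (@integrable_homtrig 0); exists K.
have iS := integrable_homtrig (homtrig_shift s hP).
have KE (f : R -> R) : la.-integrable I01 (EFin \o f) ->
    (\int[la]_(y in I01) (f y + K)%:E = \int[la]_(y in I01) (f y)%:E + K%:E)%E.
  move=> fi; under eq_integral do rewrite EFinD.
  rewrite integralD//; congr (_ + _)%E.
  by rewrite integral_cst// [X in (_ * X)%E]lebesgue_I01 mule1.
have := ge0_integral_period s (g := fun t => (P t + K)%:E).
rewrite !KE// zP => H.
have : (\int[la]_(x in I01) (P (x + s)%R)%:E + K%:E = 0 + K%:E)%E.
  apply: H.
  - apply/measurable_EFinP; apply: measurable_funD => //.
    by apply: (@continuous_measurable_fun R P); exact: homtrig_continuous hP.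
  - by move=> x; rewrite lee_fin -lerBlDr sub0r; have := hK x; rewrite ler_norml => /andP[].
  - by move=> x; rewrite P1.
by move/(congr1 (fun u => u - K%:E)%E); rewrite !addeK.
Qed.

Lemma zero_mean_center m P (a A : R) : homtrig m P -> zero_mean P ->
  (forall t, `|P t - a| <= A) -> `|a| <= A.
Proof.
move=> hP [iP zP] H.
have ic c : la.-integrable I01 (EFin \o cst c).
  by apply: (@integrable_homtrig 0); exists c.
have cE c : (\int[la]_(x in I01) c%:E = c%:E)%E.
  by rewrite integral_cst// [X in (_ * X)%E]lebesgue_I01 mule1.
rewrite ler_norml; apply/andP; split.
  have : (\int[la]_(x in I01) (P x)%:E <= \int[la]_(x in I01) (a + A)%:E)%E.
    apply: le_integral => //; first exact: ic.
    by move=> x _; rewrite lee_fin; have := H x; rewrite ler_norml => /andP[]; lra.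
  by rewrite zP cE !lee_fin; lra.
have : (\int[la]_(x in I01) (a - A)%:E <= \int[la]_(x in I01) (P x)%:E)%E.
  apply: le_integral => //; first exact: ic.
  by move=> x _; rewrite lee_fin; have := H x; rewrite ler_norml => /andP[]; lra.
by rewrite zP cE !lee_fin; lra.
Qed.

(** The threshold has to be independent of [a]. The Remez bound controls [P - a] everywhere, and the
    vanishing mean of [P] then controls [a]; the [+ 1] makes the inequality strict. *)
Lemma trig_spread d (eps C : R) : 0 < eps -> exists A : R, forall P,
  homtrig d.*2 P -> zero_mean P -> forall a y,
  (eps%:E <= la (I01 `&` [set t | (`|P t - a| < C)%R]))%E -> `|P y| < A.
Proof.
move=> eps0; have [A HA] := homtrig_remez d.*2 C eps0.
exists (A + A + 1) => P hP zP a y meas.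
have hPa : homtrig d.*2 (fun t => P t - a).
  by apply: homtrigD => //; apply: (@homtrig_widen R 0); exists (- a).
have bd := HA _ hPa meas.
have aA := zero_mean_center hP zP bd.
have := bd y; have := ler_normD (P y - a) a; rewrite subrK; lra.
Qed.

End Spread.

(** * Decoupling along the skew shift *)

Arguments Leb : simpl never.

Section Skew.
Variables (R : realType) (alpha beta : R).
Implicit Types (phi psi : R * R -> R).
Local Notation T1 := (measurableTypeR R).
Local Notation T2 := (measurableTypeR R * measurableTypeR R)%type.
Local Notation la := (@lebesgue_measure R).
Local Notation f := (skew_shift alpha beta).

(** The last term, n beta + n (n - 1) / 2 alpha in closed form, stays unevaluated: what matters is
    the shear [n%:R * z.1]. *)
Lemma iter_skew n z : iter n f z =
  (z.1 + n%:R * alpha, z.2 + n%:R * z.1 + (iter n f (0, 0)).2).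
Proof.
elim: n z => [|n IH] z; first by case: z => x y; rewrite /= !mul0r !addr0.
have E1 : (iter n f (0, 0)).1 = n%:R * alpha by rewrite IH /= add0r.
rewrite !iterS [in LHS]IH /skew_shift /= E1 -natr1.
by congr pair; ring.
Qed.

Lemma birkhoffS phi n z :
  birkhoff_sum f phi n.+1 z = birkhoff_sum f phi n z + phi (iter n f z).
Proof. by rewrite /birkhoff_sum big_nat_recr. Qed.

Lemma birkhoffD phi m n z : birkhoff_sum f phi (m + n) z =
  birkhoff_sum f phi m z + birkhoff_sum f phi n (iter m f z).
Proof.
elim: n => [|n IH]; first by rewrite addn0 /birkhoff_sum [X in _ + X]big_geq// addr0.
by rewrite addnS !birkhoffS IH addrA -iterD addnC.
Qed.

Definition periodic_set (S : set (R * R)) :=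
  forall x y, S (x + 1, y) = S (x, y) /\ S (x, y + 1) = S (x, y).

Lemma periodic_indic (S : set (R * R)) x y : periodic_set S ->
  \1_S (x + 1, y) = \1_S (x, y) :> R /\ \1_S (x, y + 1) = \1_S (x, y) :> R.
Proof. by move=> /(_ x y)[Sx Sy]; rewrite !indicE /in_mem/= /in_set/= Sx Sy. Qed.

Lemma Leb_indic (S : set (R * R)) : measurable (S : set T2) ->
  Leb S = (\int[Leb]_z (\1_S z)%:E)%E.
Proof. by move=> mS; rewrite integral_indic// setIT. Qed.

Lemma Leb_skew_set (a : R) (h : R -> R) (S : set (R * R)) :
  measurable_fun [set: T1] h -> measurable (S : set T2) -> periodic_set S ->
  Leb [set z | S (z.1 + a, z.2 + h z.1)] = Leb S.
Proof.
move=> mh mS pS.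
have mSh : measurable ([set z | S (z.1 + a, z.2 + h z.1)] : set T2).
  by have := measurable_fun_skew a mh measurableT mS; rewrite setTI.
rewrite !Leb_indic// -(integral_Leb_skew a mh (g := fun z => (\1_S z)%:E))//.
  by apply/measurable_EFinP; exact: measurable_indic.
by move=> x y; have [-> ->] := periodic_indic x y pS.
Qed.

Lemma periodic2_iter phi n x y : periodic2 phi ->
  phi (iter n f (x + 1, y)) = phi (iter n f (x, y)) /\
  phi (iter n f (x, y + 1)) = phi (iter n f (x, y)).
Proof.
move=> pphi; rewrite (iter_skew n (x + 1, y)) (iter_skew n (x, y + 1)).
rewrite (iter_skew n (x, y))/=; split.
  rewrite -[RHS](periodic2Z 1 n%:Z _ _ pphi); congr (phi (_, _)).
    by rewrite -pmulrn; ring.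
  by rewrite -pmulrn; ring.
by rewrite -[RHS](pphi _ _).2; congr (phi (_, _)); ring.
Qed.

Lemma continuous_iter phi n : continuous phi -> continuous (fun z => phi (iter n f z)).
Proof.
move=> cphi.
have -> : (fun z => phi (iter n f z)) = phi \o (fun z : R * R =>
    (z.1 + n%:R * alpha, z.2 + n%:R * z.1 + (iter n f (0, 0)).2)).
  by apply/funext => z /=; rewrite [in LHS]iter_skew.
move=> z; apply: continuous_comp; last exact: cphi.
apply: (@cvg_pair _ _ _ _ (nbhs (z.1 + n%:R * alpha))
  (nbhs (z.2 + n%:R * z.1 + (iter n f (0, 0)).2))) => /=.
  by apply: cvgD; [exact: cvg_fst|exact: cvg_cst].
apply: cvgD; last exact: cvg_cst.
apply: cvgD; first exact: cvg_snd.
by apply: cvgM; [exact: cvg_cst|exact: cvg_fst].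
Qed.

(** These properties of [vosc Phi] pass to all its Birkhoff sums with the same [d], which is why one
    threshold from [trig_spread] serves them all. *)
Definition admissible d phi := [/\ continuous phi, periodic2 phi,
  forall x, homtrig d.*2 (fun y => phi (x, y)) &
  forall x, zero_mean (fun y => phi (x, y))].

Lemma admissible_iter d phi n : admissible d phi ->
  admissible d (fun z => phi (iter n f z)).
Proof.
move=> [cphi pphi hphi zphi].
have E x : (fun y => phi (iter n f (x, y))) =
    (fun y => (fun y => phi (x + n%:R * alpha, y)) (y + (n%:R * x + (iter n f (0, 0)).2))).
  by apply/funext => y; rewrite [in LHS]iter_skew/= addrA.
split.
- exact: continuous_iter.
- by move=> x y; exact: periodic2_iter.
- by move=> x; rewrite E; exact: (homtrig_shift _ (hphi (x + n%:R * alpha))).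
- by move=> x; rewrite E; apply: (zero_mean_shift _ (hphi (x + n%:R * alpha)))
    => // t; rewrite (pphi _ t).2.
Qed.

Lemma admissible_birkhoff d phi n : admissible d phi ->
  admissible d (birkhoff_sum f phi n).
Proof.
move=> aphi; elim: n => [|n [cn pn hn zn]].
  have -> : birkhoff_sum f phi 0 = (fun=> 0).
    by apply/funext => z; rewrite /birkhoff_sum big_geq.
  split=> //; first by move=> z; exact: cvg_cst.
    by move=> x; exact: homtrig0.
  move=> x; split; first exact: integrable_homtrig (homtrig0 R 0).
  by rewrite integral0.
have [ci pi hi zi] := admissible_iter n aphi.
have -> : birkhoff_sum f phi n.+1 = fun z => birkhoff_sum f phi n z + phi (iter n f z).
  by apply/funext => z; exact: birkhoffS.
split.
- by move=> z; apply: cvgD; [exact: cn|exact: ci].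
- by move=> x y; have [-> ->] := pn x y; have [-> ->] := pi x y.
- by move=> x; apply: homtrigD.
- by move=> x; apply: zero_meanD.
Qed.

Lemma measurable_lt d (T : measurableType d) (g : T -> R) (C : R) :
  measurable_fun [set: T] g -> measurable [set z | `|g z| < C].
Proof.
move=> mg; have mn : measurable_fun [set: T] (fun z => `|g z|).
  exact: measurableT_comp.
have := measurable_fun_ltr mn (measurable_cst C).
by move=> /(_ measurableT [set true]); rewrite setTI; apply.
Qed.

(** [Leb] itself, packaged as a probability so that the sigma-finite Tonelli lemmas accept it. *)
Definition torus_probability : probability T2 R :=
  HB.pack (Measure.sort (@Leb R)) (Measure.class (@Leb R))
    (Measure_isProbability.Build _ _ _ (@Leb R) (Leb_setT R)).

Lemma measurable_fun_integral_Leb (g : (R * R) * R -> \bar R) :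
  measurable_fun [set: T2 * T1] g -> (forall z, 0 <= g z)%E ->
  measurable_fun [set: T1] (fun s => \int[Leb]_z g (z, s))%E.
Proof.
move=> mg g0.
have mg' : measurable_fun [set: T1 * T2] (fun p => g (p.2, p.1)).
  by apply: (measurableT_comp mg); exact: measurable_swap.
exact: (measurable_fun_integral_dom torus_probability measurableT mg' (fun p => g0 _)).
Qed.

Lemma ge0_fubini_Leb (D : set R) (g : (R * R) * R -> \bar R) :
  measurable (D : set T1) ->
  measurable_fun [set: T2 * T1] g -> (forall z, 0 <= g z)%E ->
  (\int[la]_(s in D) \int[Leb]_z g (z, s) = \int[Leb]_z \int[la]_(s in D) g (z, s))%E.
Proof.
move=> mD mg g0; symmetry.
exact: (ge0_fubini_dom torus_probability la measurableT mD mg g0).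
Qed.

(* Replacing x by x + s / n moves the fibre coordinate of f^n by s but barely changes
   psi; the bound results from averaging over s in [0, 1[. *)
Lemma decoupling d (eps C : R) : 0 < eps -> 0 < C -> exists A : R, forall psi,
  admissible d psi -> \forall n \near \oo,
  (Leb [set z | `|psi (iter n f z) - psi z| < C]%R <=
   eps%:E + Leb [set z | `|psi z| < A]%R)%E.
Proof.
move=> eps0 C0; have [A HA] := trig_spread d (2 * C) eps0.
exists A => psi apsi; have [cpsi ppsi hpsi zpsi] := apsi.
have C2 : 0 < C / 2 by lra.
(* Both occurrences of [psi] are displaced by [s / n]; an error below [C / 2] for each turns the
   bound [C] into [2 * C]. *)
have [e e0 he] := unif_continuous_fst cpsi ppsi C2.
near=> n.
have n0 : (0 < n)%N by near: n; exact: nbhs_infty_gt.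
have nR : n%:R != 0 :> R by rewrite pnatr_eq0 -lt0n.
have ne : n%:R^-1 < e :> R.
  rewrite invf_plt// ?posrE ?ltr0n//.
  by near: n; exact: nbhs_infty_gtr.
have mpsi := continuous_measurable_pair cpsi.
have m0 : measurable_fun [set: T1] (fun=> 0 : R) by exact: measurable_cst.
have [cin pin _ _] := admissible_iter n apsi.
have min := continuous_measurable_pair cin.
set c := (iter n f (0, 0)).2.
pose B := [set z | `|psi (iter n f z) - psi z| < C].
have mB : measurable (B : set T2).
  by apply: measurable_lt; exact: measurable_funB.
have pB : periodic_set B.
  move=> x y; rewrite /B/=; have [-> ->] := pin x y.
  by have [-> ->] := ppsi x y.
pose F (p : (R * R) * R) := psi (p.1.1 + n%:R * alpha, p.1.2 + n%:R * p.1.1 + c + p.2) - psi p.1.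
pose K := [set p | `|F p| < 2 * C].
have mF : measurable_fun [set: T2 * T1] F.
  apply: measurable_funB; last first.
    by apply: (measurableT_comp mpsi); exact: measurable_fst.
  apply: (measurableT_comp mpsi); apply/measurable_fun_pair => /=.
    apply: measurable_funD => //.
    by apply: (measurableT_comp measurable_fst); exact: measurable_fst.
  apply: measurable_funD; last exact: measurable_snd.
  apply: measurable_funD => //; apply: measurable_funD => /=.
    by apply: (measurableT_comp measurable_snd); exact: measurable_fst.
  apply: measurable_funM => //.
  by apply: (measurableT_comp measurable_fst); exact: measurable_fst.
have mK : measurable (K : set (T2 * T1)) by exact: measurable_lt.
pose W p : \bar R := (\1_K p)%:E.
have mW : measurable_fun [set: T2 * T1] W.
  by apply/measurable_EFinP; exact: measurable_indic.
have W0 p : (0 <= W p)%E by rewrite lee_fin.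
have step1 s : I01 s -> (Leb B <= \int[Leb]_z W (z, s))%E.
  rewrite /= in_itv/= => /andP[s0 s1].
  have mQ : measurable ([set z | K (z, s)] : set T2).
    exact: measurable_lt (measurable_fun_pair1 s mF).
  rewrite -(Leb_skew_set (s / n%:R) m0 mB pB).
  rewrite [leRHS](_ : _ = Leb [set z | K (z, s)]); last by rewrite [RHS]Leb_indic.
  apply: le_measure; rewrite ?inE//.
    by have := measurable_fun_skew (s / n%:R) m0 measurableT mB; rewrite setTI.
  move=> z; rewrite /B /K /F/= addr0 (iter_skew n (_, _))/= -/c.
  have -> : z.1 + s / n%:R + n%:R * alpha = z.1 + n%:R * alpha + s / n%:R by ring.
  have -> : z.2 + n%:R * (z.1 + s / n%:R) + c = z.2 + n%:R * z.1 + c + s by field.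
  have sn : `|s / n%:R| < e.
    rewrite ger0_norm ?divr_ge0//; apply: le_lt_trans ne.
    by rewrite -[leRHS]mul1r ler_wpM2r ?invr_ge0// ltW.
  have h1 := he (z.1 + n%:R * alpha) (z.2 + n%:R * z.1 + c + s) _ sn.
  have h2 := he z.1 z.2 _ sn; rewrite -surjective_pairing in h2.
  move: h1 h2; rewrite !ltr_norml => /andP[? ?] /andP[? ?] /andP[? ?].
  by apply/andP; split; lra.
(* The [+ 0] puts [G] in the form required by [Leb_skew_set], with a constant shear. *)
pose G := [set z | `|psi (z.1 + n%:R * alpha, z.2 + 0)| < A].
have mG : measurable (G : set T2).
  apply: measurable_lt; apply: (measurableT_comp mpsi).
  exact: (measurable_fun_skew (n%:R * alpha) m0).
(* For fixed [z] the section is, up to translation, the set where the polynomial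
   [psi (z.1 + n%:R * alpha, _)] is within [2 * C] of the constant [psi z]. By [trig_spread] its
   measure is below [eps], unless the polynomial is below [A] on its whole fibre, in particular at
   [z.2]. *)
have step3 z : (\int[la]_(s in I01) W (z, s) <= eps%:E + (\1_G z)%:E)%E.
  pose S := [set s | `|psi (z.1 + n%:R * alpha, s) - psi z| < 2 * C].
  have mS : measurable (S : set T1).
    apply: measurable_lt; apply: measurable_funB => //.
    exact: measurable_fun_pair2 mpsi.
  have -> : (\int[la]_(s in I01) W (z, s) = la (I01 `&` S))%E.
    rewrite -(lebesgue_period (z.2 + n%:R * z.1 + c) mS); last first.
      by move=> s; rewrite /S/= (ppsi _ _).2.
    rewrite setIC -integral_indic//; last first.
      have ms : measurable_fun [set: T1]
        ((fun x => x + (z.2 + n%:R * z.1 + c)) : T1 -> T1) by exact: measurable_funD.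
      by have := ms measurableT _ mS; rewrite setTI.
    apply: eq_integral => s _; rewrite /W /K !indicE /in_mem/= /in_set/=.
    by rewrite /F/= /S/= (addrC s).
  rewrite indicE; have [zG|zG] := boolP (z \in G).
    apply: (@le_trans _ _ 1%E); last by rewrite leeDr// lee_fin ltW.
    rewrite -[leRHS](lebesgue_I01 R); apply: le_measure; rewrite ?inE//.
    exact: measurableI.
  rewrite adde0 leNgt; apply/negP => /ltW.
  move=> /(HA _ (hpsi (z.1 + n%:R * alpha)) (zpsi _) _ z.2) h.
  by move/negP: zG; apply; rewrite inE /G/= addr0.
have -> : Leb [set z | `|psi z| < A] = Leb G.
  have mA : measurable ([set z | `|psi z| < A] : set T2) by exact: measurable_lt.
  rewrite -(Leb_skew_set (n%:R * alpha) m0 mA)//.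
  by move=> x y /=; have [-> ->] := ppsi x y.
have mG1 : measurable_fun [set: T2] (fun z => (\1_G z)%:E : \bar R).
  by apply/measurable_EFinP; exact: measurable_indic.
rewrite -/B.
have -> : Leb B = (\int[la]_(s in I01) Leb B)%E.
  by rewrite integral_cst// [X in (_ * X)%E]lebesgue_I01 mule1.
apply: (@le_trans _ _ (\int[la]_(s in I01) \int[Leb]_z W (z, s))%E).
  apply: ge0_le_integral => //.
  - exact: measurable_funTS (measurable_fun_integral_Leb mW W0).
rewrite ge0_fubini_Leb//.
apply: (@le_trans _ _ (\int[Leb]_z (eps%:E + (\1_G z)%:E))%E).
  apply: ge0_le_integral => //.
  - by move=> z _; exact: integral_ge0.
  - exact: measurable_fun_integral_dom.
  - exact: emeasurable_funD.
rewrite ge0_integralD//; last by move=> ? _; rewrite lee_fin ltW.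
by rewrite integral_cst// [X in (_ * X)%E]Leb_setT mule1 -Leb_indic.
Unshelve. all: by end_near.
Qed.

End Skew.

(** * Ergodicity of the skew shift *)

Section RotationErgodic.
Variable R : realType.
Local Notation T1 := (measurableTypeR R).
Local Notation la := (@lebesgue_measure R).
Implicit Types M : set R.

Lemma measurable_shift_set (s : R) M : measurable (M : set T1) ->
  measurable ([set x | M (x + s)] : set T1).
Proof.
move=> mM; have ms : measurable_fun [set: T1] ((fun x => x + s) : T1 -> T1).
  exact: measurable_funD.
by have := ms measurableT _ mM; rewrite setTI.
Qed.

(** Choose a compact [V] inside the set and an open [U] around [V], each losing less than [e / 2];
    small translations keep [V] inside [U]. A point leaving [M] is either outside [V] or is moved
    into [U] minus [V]. *)
Lemma translation_deficit M (e : R) : measurable (M : set T1) -> 0 < e ->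
  exists2 eta : R, 0 < eta & forall u, `|u| < eta ->
    (la (I01 `&` [set x | M x /\ ~ M (x + u)%R]) <= e%:E)%E.
Proof.
move=> mM e0; have e2 : 0 < e / 2 by lra.
have mD : measurable ((I01 `&` M) : set T1) by exact: measurableI.
have Dfin : (la (I01 `&` M) < +oo)%E.
  apply: (@le_lt_trans _ _ 1%E); last by rewrite ltry.
  rewrite -[leRHS](lebesgue_I01 R); apply: le_measure; rewrite ?inE//.
have [V [cV VD DV]] := lebesgue_regularity_inner mD Dfin e2.
have mV : measurable (V : set T1) by exact: compact_measurable.
have Vfin : (la V < +oo)%E.
  by apply: le_lt_trans Dfin; apply: le_measure; rewrite ?inE.
have [U [oU VU UV]] := lebesgue_regularity_outer mV Vfin e2.
have mU : measurable (U : set T1) by exact: open_measurable.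
have /compact_near_coveringP := cV.
move=> /(_ R (nbhs (0 : R)) (fun u x => U (x + u)) _).
case.
  move=> x Vx.
  have /nbhs_ballP[d /= d0 dU] : nbhs x U by apply: open_nbhs_nbhs; split => //; exact: VU.
  have d2 : 0 < d / 2 by lra.
  exists (ball x (d / 2), ball (0 : R) (d / 2)).
    by split; exact: nbhsx_ballx.
  move=> [y u] [/= yx u0]; apply: dU; move: yx u0; rewrite -!ball_normE/= sub0r normrN.
  move=> yx u0; rewrite opprD addrA; apply: le_lt_trans (ler_normB _ _) _.
  by lra.
move=> eta /= eta0 H; exists eta => // u ueta.
have {}H x : V x -> U (x + u) by apply: H; rewrite /= sub0r normrN.
have mUV : measurable ([set x | (U `\` V) (x + u)] : set T1).
  by apply: measurable_shift_set; exact: measurableD.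
have mDV : measurable (((I01 `&` M) `\` V) : set T1) by exact: measurableD.
apply: (@le_trans _ _ (la ((I01 `&` M) `\` V) + la [set x | (U `\` V) (x + u)%R])%E).
  apply: le_trans (measureU2 _ mDV mUV).
  apply: le_measure; rewrite ?inE//.
  - apply: measurableI => //; apply: measurableI => //.
    by apply: measurableC; exact: measurable_shift_set.
  - exact: measurableU.
  - move=> x [Ix [Mx nM]]; have [Vx|nVx] := pselect (V x); last by left.
    right; split; first exact: H.
    by move=> /VD[_].
have -> : la [set x | (U `\` V) (x + u)] = la (U `\` V).
  exact: (lebesgue_measure_shift u (measurableD mU mV)).
by rewrite [e](splitr e) EFinD; apply: leeD; exact: ltW.
Qed.

(** Dirichlet's pigeonhole: among [N.+1] fractional parts of multiples of [alpha], two share a box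
    of width [1 / N]. Irrationality makes their difference nonzero. *)
Lemma small_period (alpha : R) M : irrational alpha ->
  (forall x, M (x + 1) = M x) -> (forall x, M (x + alpha) = M x) ->
  forall e : R, 0 < e -> exists p, [/\ p != 0, `|p| < e & forall x, M (x + p) = M x].
Proof.
move=> ialpha M1 Ma e e0.
have Man n x : M (x + n%:R * alpha) = M x.
  by elim: n x => [|n IH] x; rewrite ?mul0r ?addr0// -natr1 mulrDl mul1r addrA Ma.
have [N N0 Ne] : exists2 N, (0 < N)%N & N%:R^-1 < e :> R.
  exists (Num.bound e^-1).+1 => //; rewrite invf_plt ?posrE ?ltr0n//.
  by apply: lt_trans (archi_boundP _) _; rewrite ?ltr_nat// invr_ge0 ltW.
have N0R : 0 < N%:R :> R by rewrite ltr0n.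
pose fr (i : nat) : R := i%:R * alpha - (Num.floor (i%:R * alpha))%:~R.
have fr01 i : 0 <= fr i < 1.
  have /andP[h1 h2] := mem_rg1_floor (i%:R * alpha).
  by rewrite subr_ge0 h1/= ltrBlDl.
pose bx i : nat := Num.truncn (fr i * N%:R).
have bxN i : (bx i < N)%N.
  rewrite /bx; have /andP[h1 h2] := fr01 i.
  have /truncn_itv/andP[h _] : 0 <= fr i * N%:R by rewrite mulr_ge0.
  rewrite -(ltr_nat R); apply: le_lt_trans h _.
  by rewrite -[ltRHS]mul1r ltr_pM2r.
have /injectivePn[i [j ij bij]] : ~~ injectiveb (fun i : 'I_N.+1 => Ordinal (bxN i)).
  by apply/injectiveP => /leq_card; rewrite !card_ord ltnn.
wlog ltij : i j ij bij / (i < j)%N.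
  move=> H; have := ij; rewrite neq_ltn => /orP[h|h]; first exact: H h.
  by apply: (H j i) => //; rewrite eq_sym.
exists (fr j - fr i); split.
- apply/eqP => /eqP; rewrite subr_eq0 => /eqP fij.
  apply: ialpha; apply/rationalP.
  exists (Num.floor (j%:R * alpha) - Num.floor (i%:R * alpha)), (j - i)%N.
  have ji0 : (j - i)%:R != 0 :> R by rewrite pnatr_eq0 subn_eq0 -ltnNge.
  apply: (mulIf ji0); rewrite divfK// natrB 1?ltnW// intrB.
  by move: fij; rewrite /fr; lra.
- have : bx i = bx j by have := congr1 val bij.
  have /truncn_itv/andP[h1 h2] : 0 <= fr i * N%:R by rewrite mulr_ge0// (andP (fr01 i)).1.
  have /truncn_itv/andP[h3 h4] : 0 <= fr j * N%:R by rewrite mulr_ge0// (andP (fr01 j)).1.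
  move=> bE; rewrite -/(bx i) in h1 h2; rewrite -/(bx j) -bE in h3 h4.
  apply: lt_trans Ne; rewrite -(ltr_pM2r N0R) mulVf ?gt_eqF//.
  rewrite -[X in _ * X](ger0_norm (ltW N0R)) -normrM ltr_norml.
  move: h2 h4; rewrite -natr1 => h2 h4.
  by rewrite mulrBl; apply/andP; split; lra.
- move=> x.
  have -> : x + (fr j - fr i) = x + j%:R * alpha - i%:R * alpha +
     (Num.floor (i%:R * alpha) - Num.floor (j%:R * alpha))%:~R.
    by rewrite /fr intrB; ring.
  rewrite (periodicZ _ M1) -(Man i) subrK Man//.
Qed.

End RotationErgodic.

Section Ergodic.
Variable R : realType.
Local Notation T1 := (measurableTypeR R).
Local Notation T2 := (measurableTypeR R * measurableTypeR R)%type.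
Local Notation la := (@lebesgue_measure R).

Lemma ge0_cvg0 (u : nat -> \bar R) : (forall j, 0 <= u j)%E ->
  (forall e : R, 0 < e -> \forall j \near \oo, (u j <= e%:E)%E) ->
  u j @[j --> \oo] --> 0%E.
Proof.
move=> u0 ue; apply/fine_cvgP; split.
  apply: filterS (ue _ ltr01) => j uj.
  by rewrite ge0_fin_numE//; apply: le_lt_trans uj _; rewrite ltry.
apply/cvgr0Pnorm_le => e e0; apply: filterS (ue _ e0) => j uj /=.
rewrite ger0_norm ?fine_ge0// -lee_fin fineK// ge0_fin_numE//.
by apply: le_lt_trans uj _; rewrite ltry.
Qed.

(** Arbitrarily small periods make [M] invariant, up to null sets, under every translation [t].
    Integrating over [t] the measure of the points of [M] sent outside [M] gives the product of the
    measures of [M] and its complement, which is therefore 0. *)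
Lemma rotation_ergodic (alpha : R) (M : set R) : irrational alpha ->
  measurable (M : set T1) ->
  (forall x, M (x + 1) = M x) -> (forall x, M (x + alpha) = M x) ->
  la (I01 `&` M) = 0%E \/ la (I01 `&` ~` M) = 0%E.
Proof.
move=> ialpha mM M1 Ma.
have mnM : measurable (~` M : set T1) by exact: measurableC.
have deficit0 t : la (I01 `&` [set x | M x /\ ~ M (x + t)]) = 0%E.
  apply/eqP; rewrite -measure_le0; apply/lee_addgt0Pr => e e0; rewrite add0e.
  have [eta eta0 H] := translation_deficit mM e0.
  have [p [p0 peta pM]] := small_period ialpha M1 Ma eta0.
  (* Only the remainder of [t] modulo [p] matters, and it is smaller than [eta]. *)
  pose k := Num.floor (t / p).
  have ET : (fun x => M (x + t)) = (fun x => M (x + (t - k%:~R * p))).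
    apply/funext => x.
    have := @periodicZ R _ (fun y => M (y * p + (x + (t - k%:~R * p)))) k.
    move=> /(_ _ 0); rewrite !add0r mul0r add0r => <-.
      by congr M; ring.
    by move=> y; rewrite mulrDl mul1r addrAC pM.
  have -> : [set x | M x /\ ~ M (x + t)] =
      [set x | M x /\ ~ M (x + (t - k%:~R * p))].
    by apply/funext => x /=; rewrite (congr1 (fun g => g x) ET).
  apply: H; apply: le_lt_trans peta.
  have -> : t - k%:~R * p = p * (t / p - k%:~R) by field.
  have /andP[h1 h2] := mem_rg1_floor (t / p).
  by rewrite normrM ler_piMr// ler_norml; apply/andP; split; rewrite /k; lra.
pose q := la (I01 `&` ~` M).
pose K := [set z : R * R | M z.1 /\ ~ M (z.1 + z.2)].
have mK : measurable (K : set T2).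
  apply: measurableI.
    by have := @measurable_fst _ _ T1 T1 measurableT _ mM; rewrite setTI.
  have mD : measurable_fun [set: T2] ((fun z => z.1 + z.2) : T2 -> T1).
    by apply: measurable_funD; [exact: measurable_fst|exact: measurable_snd].
  by have := mD measurableT _ mnM; rewrite setTI.
pose W z : \bar R := (\1_K z)%:E.
have mW : measurable_fun [set: T2] W.
  by apply/measurable_EFinP; exact: measurable_indic.
have W0 z : (0 <= W z)%E by rewrite lee_fin.
have E0 : (\int[la]_(t in I01) \int[la]_(x in I01) W (x, t) = 0)%E.
  apply: integral0_eq => t _; rewrite -[RHS](deficit0 t) setIC -integral_indic//.
  by apply: measurableI => //; exact: measurable_shift_set mnM.
have E1 : (\int[la]_(x in I01) \int[la]_(t in I01) W (x, t) = la (I01 `&` M) * q)%E.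
  rewrite (setIC I01) -integral_indic// -ge0_integralZr//; last 2 first.
  - by apply/measurable_EFinP; exact: measurable_indic.
  - exact: measure_ge0.
  apply: eq_integral => x _; rewrite indicE; have [Mx|nMx] := boolP (x \in M).
    rewrite mul1e /q -(lebesgue_period x mnM); last by move=> y; rewrite /setC/= M1.
    rewrite setIC -integral_indic//; last exact: measurable_shift_set mnM.
    apply: eq_integral => t _; rewrite /W /K !indicE; congr ((_ : bool)%:R)%:E.
    apply/idP/idP; rewrite !inE/= addrC; last by move=> ?; split => //; rewrite inE in Mx.
    by case.
  rewrite mul0e integral0_eq// => t _.
  rewrite /W indicE memNset// => -[Mx _].
  by move/negP: nMx; apply; rewrite inE.
move: E0; rewrite -ge0_fubini_dom// E1 => /eqP; rewrite mule_eq0.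
by move=> /orP[] /eqP ?; [left|right].
Qed.

Variables (alpha beta : R) (E : set (R * R)).
Hypotheses (ialpha : irrational alpha) (mE : measurable (E : set T2))
  (pE : periodic_set E) (fE : forall z, E (skew_shift alpha beta z) = E z).

Let S (d s : R) := [set z | E z /\ ~ E (z.1 + d, z.2 + s)].

Let mshift (d s : R) : measurable ([set z | E (z.1 + d, z.2 + s)] : set T2).
Proof.
by have := measurable_fun_skew d (measurable_cst s) measurableT mE; rewrite setTI.
Qed.

Let mS d s : measurable (S d s : set T2).
Proof. by apply: measurableI => //; apply: measurableC; exact: mshift. Qed.

Let pS d s : periodic_set (S d s).
Proof.
move=> x y; rewrite /S/=; have [-> ->] := pE x y.
by have [Ex Ey] := pE (x + d) (y + s); rewrite !(addrAC _ 1) Ex Ey.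
Qed.

(* Since f z + (d, s) = f (z + (d, s - d)), iterating j times with d = s / j and
   letting j tend to infinity shows that E is invariant under the vertical translation by s. *)
Let translate d s : Leb (S d s) = Leb (S d (s - d)).
Proof.
have mh : measurable_fun [set: T1] (fun x : R => x + beta) by exact: measurable_funD.
rewrite -(Leb_skew_set alpha mh (mS d s) (pS d s)); congr (Leb _).
have fz z : (z.1 + alpha, z.2 + (z.1 + beta)) = skew_shift alpha beta z.
  by rewrite /skew_shift addrA.
apply/funext => z; rewrite /S/= fz fE; congr (_ /\ ~ _).
rewrite -[RHS]fE /skew_shift/=; congr (E (_, _)); ring.
Qed.

Let translateM d j : Leb (S d (j%:R * d)) = Leb (S d 0).
Proof.
elim: j => [|j IH]; first by rewrite mul0r.
by rewrite translate -IH -natr1 mulrDl mul1r addrK.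
Qed.

(** [translation_deficit] gives convergence on each horizontal line at a rate depending on the line;
    dominated convergence integrates over the lines. *)
Let deficit_cvg (u : nat -> R) : u j @[j --> \oo] --> 0 ->
  Leb (S (u j) 0) @[j --> \oo] --> 0%E.
Proof.
move=> u0.
have mSy j y : measurable ([set x | S (u j) 0 (x, y)] : set T1).
  by have := pair2_measurable y measurableT (mS (u j) 0); rewrite setTI.
pose h j y := la (I01 `&` [set x | S (u j) 0 (x, y)]).
have hE j : Leb (S (u j) 0) = (\int[la]_(y in I01) h j y)%E.
  rewrite Leb_indic// integral_Leb_swap//; last first.
    by apply/measurable_EFinP; exact: measurable_indic.
  by apply: eq_integral => y _; rewrite /h setIC -integral_indic.
have h01 j y : (0 <= h j y <= 1)%E.
  rewrite measure_ge0/= -(lebesgue_I01 R); apply: le_measure; rewrite ?inE//.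
  exact: measurableI.
have mh j : measurable_fun [set: T1] (h j).
  have -> : h j = (fun y => \int[la]_(x in I01) (\1_(S (u j) 0) (x, y))%:E)%E.
    by apply/funext => y; rewrite /h setIC -integral_indic.
  have mW : measurable_fun [set: T1 * T1] (fun z => (\1_(S (u j) 0) (z.2, z.1))%:E : \bar R).
    have mI : measurable_fun [set: T2] (\1_(S (u j) 0) : T2 -> R) by exact: measurable_indic.
    by apply/measurable_EFinP; apply: (measurableT_comp mI); exact: measurable_swap.
  exact: (measurable_fun_integral_dom la (measurable_itv `[0, 1[) mW (fun _ => _)).
have hcvg y : h j y @[j --> \oo] --> 0%E.
  have mEy : measurable ([set x | E (x, y)] : set T1).
    by have := pair2_measurable y measurableT mE; rewrite setTI.
  apply: ge0_cvg0 => [j|e e0]; first by have /andP[] := h01 j y.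
  have [eta eta0 H] := translation_deficit mEy e0.
  have /cvgr0Pnorm_lt/(_ _ eta0) := u0; apply: filterS => j uj.
  by have := H _ uj; rewrite /h/S/= addr0.
have ic : la.-integrable I01 (cst 1%E : R -> \bar R).
  by apply: (@integrable_homtrig R 0 (cst 1)); exists 1.
have mI : measurable (I01 : set T1) by [].
have H1 j : measurable_fun (I01 : set T1) (h j) by exact: measurable_funTS.
have H2 : {ae la, forall y, I01 y -> h j y @[j --> \oo] --> cst 0%E y}.
  by apply: aeW => y _; exact: hcvg.
have H3 : {ae la, forall y j, I01 y -> (`|h j y| <= cst 1%E y)%E}.
  by apply: aeW => y j _; have /andP[h0 h1] := h01 j y; rewrite gee0_abs.
have [_ _ H] := @dominated_convergence _ _ _ la I01 mI h (cst 0%E) (cst 1%E)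
  H1 (measurable_cst _) H2 ic H3.
move: H; rewrite integral0; apply: cvg_trans; apply: near_eq_cvg.
by apply: nearW => j /=; rewrite hE.
Qed.

Let vertical s : Leb (S 0 s) = 0%E.
Proof.
pose u (j : nat) : R := s / j.+1%:R.
have u0 : u j @[j --> \oo] --> (0 : R).
  rewrite -(mulr0 s); apply: cvgM; first exact: cvg_cst.
  exact: cvg_harmonic.
have nu0 : - u j @[j --> \oo] --> (0 : R) by rewrite -oppr0; exact: cvgN.
(* Go from [z] to [z + (0, s)] through [z + (u j, s)]: a point that leaves [E] does so in one of the
   two moves. The choice [s = j.+1 * u j] lets [translateM] reduce the first move to a small
   horizontal one. *)
have le j : (Leb (S 0%R s) <= Leb (S (u j) 0%R) + Leb (S (- u j) 0%R))%E.
  have -> : Leb (S (u j) 0) = Leb (S (u j) s).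
    rewrite -(translateM (u j) j.+1); congr (Leb (S _ _)).
    by rewrite /u mulrC divfK.
  rewrite -(Leb_skew_set (u j) (measurable_cst s) (mS (- u j) 0) (pS (- u j) 0)).
  have mS' : measurable ([set z | S (- u j) 0 (z.1 + u j, z.2 + s)] : set T2).
    by have := measurable_fun_skew (u j) (measurable_cst s) measurableT (mS (- u j) 0);
       rewrite setTI.
  apply: le_trans (measureU2 _ (mS _ _) mS').
  apply: le_measure; rewrite ?inE//; first exact: measurableU.
  move=> z; rewrite /S/= !addr0 addrK => -[Ez nEz].
  by have [?|?] := pselect (E (z.1 + u j, z.2 + s)); [right|left].
apply/eqP; rewrite -measure_le0.
have lim : (Leb (S (u j) 0%R) + Leb (S (- u j) 0%R))%E @[j --> \oo] --> (0 + 0)%E.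
  by apply: cvgeD => //; exact: deficit_cvg.
by rewrite -(adde0 0%E); apply: (cvge_to_ge lim); exact: nearW.
Qed.

(** Vertical invariance, integrated over [s], gives [q x * m x = 0] almost everywhere: each fibre of
    [E] is null or full. The set [M] of base points with full fibre is invariant under the rotation,
    whose ergodicity decides between the two cases. *)
Lemma skew_shift_ergodic : Leb E = 0%E \/ Leb (~` E) = 0%E.
Proof.
have nE : measurable (~` E : set T2) by exact: measurableC.
pose q x := la (I01 `&` [set y | ~ E (x, y)]).
pose m x := la (I01 `&` [set y | E (x, y)]).
have mEx x : measurable ([set y | E (x, y)] : set T1).
  by have := pair1_measurable x measurableT mE; rewrite setTI.
have mnEx x : measurable ([set y | ~ E (x, y)] : set T1) by exact: measurableC (mEx x).
have indE (A : set (R * R)) x : measurable ([set y | A (x, y)] : set T1) ->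
    (\int[la]_(y in I01) (\1_A (x, y))%:E = la (I01 `&` [set y | A (x, y)]))%E.
  by move=> mA; rewrite setIC -integral_indic.
have mind (A : set (R * R)) : measurable (A : set T2) ->
    measurable_fun [set: T2] (fun z => (\1_A z)%:E : \bar R).
  by move=> mA; apply/measurable_EFinP; exact: measurable_indic.
have ind0 (A : set (R * R)) z : (0 <= (\1_A z)%:E :> \bar R)%E by rewrite lee_fin.
have LebE : Leb E = (\int[la]_(x in I01) m x)%E.
  rewrite Leb_indic// integral_Leb//; last exact: mind.
  by apply: eq_integral => x _; rewrite indE.
have LebnE : Leb (~` E) = (\int[la]_(x in I01) q x)%E.
  rewrite Leb_indic// integral_Leb//; last exact: mind.
  by apply: eq_integral => x _; rewrite indE//; exact: mnEx.
have mq : measurable_fun [set: T1] q.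
  have -> : q = (fun x => \int[la]_(y in I01) (\1_(~` E) (x, y))%:E)%E.
    by apply/funext => x; rewrite indE//; exact: mnEx.
  exact: (measurable_fun_integral_dom la _ (mind _ nE) (ind0 _)).
have mm : measurable_fun [set: T1] m.
  have -> : m = (fun x => \int[la]_(y in I01) (\1_E (x, y))%:E)%E.
    by apply/funext => x; rewrite indE.
  exact: (measurable_fun_integral_dom la _ (mind _ mE) (ind0 _)).
have q0 x : (0 <= q x)%E by exact: measure_ge0.
have m0 x : (0 <= m x)%E by exact: measure_ge0.
pose K := [set p : (R * R) * R | S 0 p.2 p.1].
have mK : measurable (K : set (T2 * T1)).
  have m1 : measurable ([set p | E p.1] : set (T2 * T1)).
    by have := @measurable_fst _ _ T2 T1 measurableT _ mE; rewrite setTI.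
  apply: measurableI => //; apply: measurableC.
  have mf : measurable_fun [set: T2 * T1]
      ((fun p => (p.1.1 + 0, p.1.2 + p.2)) : T2 * T1 -> T2).
    apply/measurable_fun_pair => /=.
      apply: measurable_funD => //.
      by apply: (measurableT_comp measurable_fst); exact: measurable_fst.
    apply: measurable_funD; last exact: measurable_snd.
    by apply: (measurableT_comp measurable_snd); exact: measurable_fst.
  by have := mf measurableT _ mE; rewrite setTI.
have mW : measurable_fun [set: T2 * T1] (fun p => (\1_K p)%:E : \bar R).
  by apply/measurable_EFinP; exact: measurable_indic.
have qm0 : (\int[la]_(x in I01) `|q x * m x| = 0)%E.
  transitivity (\int[la]_(s in I01) \int[Leb]_z (\1_K (z, s))%:E)%E; last first.
    apply: integral0_eq => s _; rewrite -[RHS](vertical s) Leb_indic//.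
  have Wge0 (p : (R * R) * R) : (0 <= (\1_K p)%:E :> \bar R)%E by rewrite lee_fin.
  have mI : measurable (I01 : set T1) by [].
  rewrite -[RHS]/(\int[la]_(s in I01) \int[Leb]_z (fun p => (\1_K p)%:E) (z, s))%E.
  rewrite (ge0_fubini_Leb mI mW Wge0).
  transitivity (\int[Leb]_z (q z.1 * (\1_E z)%:E))%E.
    rewrite integral_Leb//; last 2 first.
    - apply: emeasurable_funM; last exact: mind.
      by apply: (measurableT_comp mq); exact: measurable_fst.
    - by move=> z; rewrite mule_ge0.
    apply: eq_integral => x _; rewrite gee0_abs ?mule_ge0//= ge0_integralZl//.
    - by rewrite indE.
    - exact: measurable_funTS (measurable_fun_pair2 _ (mind _ mE)).
  apply: eq_integral => z _; rewrite indicE; have [zE|nzE] := boolP (z \in E).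
    rewrite mule1 /q -(lebesgue_period z.2 (mnEx z.1)); last first.
      by move=> y /=; rewrite (pE _ _).2.
    rewrite setIC -integral_indic//; last exact: measurable_shift_set (mnEx _).
    apply: eq_integral => t _; rewrite !indicE; congr ((nat_of_bool _)%:R)%:E.
    apply/idP/idP; rewrite !inE/K/S/= addr0 (addrC t) => //.
      by move=> ?; split => //; rewrite inE in zE.
    by case.
  rewrite mule0 integral0_eq// => t _.
  rewrite indicE memNset// => -[Ez _].
  by move/negP: nzE; apply; rewrite inE.
have aeqm : ae_eq la I01 (fun x => q x * m x)%E (cst 0%E).
  apply/ae_eq_integral_abs => //.
  by apply: measurable_funTS; exact: emeasurable_funM.
pose M := [set x | q x = 0%E].
have mM : measurable (M : set T1).
  by have := mq measurableT _ (emeasurable_set1 0%E); rewrite setTI.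
have M1 x : M (x + 1) = M x.
  rewrite /M/= /q; congr (la (_ `&` _) = _); apply/funext => y /=.
  by rewrite (pE _ _).1.
have Ma x : M (x + alpha) = M x.
  rewrite /M/= /q -(lebesgue_period (x + beta) (mnEx (x + alpha))); last first.
    by move=> y /=; rewrite (pE _ _).2.
  congr (la (_ `&` _) = _); apply/funext => y /=; congr (~ _).
  by rewrite -[RHS]fE /skew_shift/= addrA.
have negl (A : set R) (P : R -> Prop) : la (I01 `&` A) = 0%E -> measurable (A : set T1) ->
    (forall x, ~ A x -> P x) -> {ae la, forall x, I01 x -> P x}.
  move=> A0 mA AP; exists (I01 `&` A); split => //; first exact: measurableI.
  move=> x /= nP; apply: contrapT => nIA; apply: nP => Ix; apply: AP => Ax.
  by apply: nIA.
have [M0|M0] := rotation_ergodic ialpha mM M1 Ma.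
  left; rewrite LebE.
  have := negl _ (fun x => q x <> 0%E) M0 mM (fun x => id).
  move=> aeq; rewrite (ge0_ae_eq_integral (g := cst 0%E))//.
  - by rewrite integral0.
  - exact: measurable_funTS.
  apply: filterS2 aeqm aeq => x /= qm qn Ix.
  have /eqP := qm Ix; rewrite mule_eq0 => /orP[/eqP/(qn Ix)//|/eqP //].
right; rewrite LebnE.
have mnM : measurable (~` M : set T1) by exact: measurableC.
have aeq := negl _ (fun x => q x = 0%E) M0 mnM (fun x => @contrapT _).
rewrite (ge0_ae_eq_integral (g := cst 0%E))//.
- by rewrite integral0.
- exact: measurable_funTS.
Qed.

End Ergodic.

(** * Visit frequencies and the maximal inequality *)

Section Counting.
Variables (R : realType) (c : nat -> R) (lam : R) (L : nat).

(** A boolean, so that bad times can be counted in a sum; [N.+1] ranges over the window lengths 1 to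
    [L]. *)
Definition exceeds n := [exists N : 'I_L, lam * N.+1%:R <= \sum_(n <= i < n + N.+1) c i].

(* Greedy covering of the bad times by disjoint windows. *)
Lemma maximal_counting : (forall i, 0 <= c i) -> 0 <= lam -> forall T n0,
  lam * \sum_(n0 <= n < n0 + T) (exceeds n)%:R <= \sum_(n0 <= i < n0 + T + L) c i.
Proof.
move=> c0 lam0.
have csub a b d : (a <= b)%N -> (b <= d)%N ->
    \sum_(a <= i < b) c i <= \sum_(a <= i < d) c i.
  by move=> ab bd; rewrite [leRHS](big_cat_nat ab bd)/= lerDl sumr_ge0.
have e1 a k : \sum_(a <= n < a + k) (exceeds n)%:R <= k%:R :> R.
  apply: (@le_trans _ _ (\sum_(a <= n < a + k) 1)).
    by apply: ler_sum => n _; rewrite lern1 leq_b1.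
  by rewrite sumr_const_nat addKn.
elim/ltn_ind => -[|T] IH n0.
  by rewrite addn0 big_geq// mulr0 sumr_ge0.
have [/existsP[N hN]|/negbTE ne] := boolP (exceeds n0).
  (* A window that overruns the range is paid for by the extra [L] terms on the right. Otherwise it
     pays for the [N.+1] times it covers, and the induction restarts after it. *)
  have [TN|NT] := leqP T.+1 N.+1.
    apply: (@le_trans _ _ (lam * N.+1%:R)).
      by apply: ler_wpM2l => //; apply: le_trans (e1 _ _) _; rewrite ler_nat.
    apply: le_trans hN _; apply: csub; first exact: leq_addr.
    by rewrite -addnA leq_add2l (leq_trans (ltn_ord N))// leq_addl.
  have TE : T.+1 = (N.+1 + (T.+1 - N.+1))%N by rewrite subnKC// ltnW.
  rewrite [in leLHS]TE addnA (big_cat_nat (n := (n0 + N.+1)%N)) ?leq_addr//= mulrDr.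
  rewrite [leRHS](big_cat_nat (n := (n0 + N.+1)%N)) ?leq_addr//=; last first.
    by rewrite -addnA leq_add2l (leq_trans (ltnW NT))// leq_addr.
  apply: lerD.
    by apply: le_trans hN; apply: ler_wpM2l.
  have := IH (T.+1 - N.+1)%N _ (n0 + N.+1)%N.
  rewrite -[X in (_ < X)%N]subn0 ltn_sub2l// => /(_ isT); move/le_trans; apply.
  by rewrite -(addnA n0) -TE.
have nT : (n0 < n0 + T.+1)%N by rewrite addnS ltnS leq_addr.
rewrite (big_ltn nT) ne add0r -addSnnS.
apply: le_trans (IH T _ n0.+1) _ => //.
by rewrite [leRHS]big_ltn ?lerDr// -addnA addSn ltnS leq_addr.
Qed.

End Counting.

Section Tent.
Variables (R : realType) (K : R).
Hypothesis K0 : 0 < K.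
Local Notation T1 := (measurableTypeR R).
Local Notation la := (@lebesgue_measure R).

(** A Lipschitz cut-off rather than an indicator: visit counts then depend continuously on the
    height, which makes the recurrent heights an open set. *)
Definition tent (t : R) : R := Num.max 0 (1 - `|t| / K).

Lemma tent_ge0 t : 0 <= tent t. Proof. by rewrite le_max lexx. Qed.

Lemma tent_le1 t : tent t <= 1.
Proof. by rewrite ge_max ler01/= gerBl divr_ge0// ltW. Qed.

Lemma tent_lip s t : tent s <= tent t + `|s - t| / K.
Proof.
rewrite [tent s]/tent ge_max; apply/andP; split.
  by rewrite addr_ge0 ?tent_ge0// divr_ge0// ltW.
have h : `|t| / K <= `|s| / K + `|s - t| / K.
  rewrite -mulrDl ler_pM2r ?invr_gt0//.
  by have := ler_normB s (s - t); rewrite opprB addrC subrK.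
have : 1 - `|t| / K <= tent t by rewrite /tent le_max lexx orbT.
lra.
Qed.


Lemma tent_half t : `|t| < K / 2 -> 2^-1 <= tent t.
Proof.
move=> tK; rewrite /tent le_max; apply/orP; right.
have : `|t| / K < 2^-1 by rewrite ltr_pdivrMr// mulrC.
lra.
Qed.

Lemma tent_measurable : measurable_fun [set: T1] tent.
Proof.
apply: measurable_maxr => //.
apply: measurable_funB => //.
by apply: measurable_funM => //; apply: measurableT_comp.
Qed.

Lemma integral_tent : (\int[la]_t (tent t)%:E <= (2 * K)%:E)%E.
Proof.
apply: (@le_trans _ _ (\int[la]_t (\1_(`[- K, K]%classic) t)%:E)%E).
  apply: ge0_le_integral => //.
  - by move=> t _; rewrite lee_fin tent_ge0.
  - by apply/measurable_EFinP; exact: tent_measurable.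
  - by apply/measurable_EFinP; exact: measurable_indic.
  move=> t _; rewrite lee_fin indicE; have [h|h] := boolP (t \in _).
    exact: tent_le1.
  rewrite /tent ge_max lexx/= subr_le0 ler_pdivlMr// mul1r leNgt; apply/negP => tK.
  move/negP: h; apply; rewrite inE/= in_itv/=.
  by move: tK; rewrite ltr_norml => /andP[? ?]; apply/andP; split; exact: ltW.
rewrite [leLHS](_ : _ = la `[- K, K]%classic); last by rewrite integral_indic// setIT.
rewrite lebesgue_measure_itv/= lte_fin gtrN// -EFinD lee_fin.
by lra.
Qed.

End Tent.

(** * Upper visit frequencies of the real extension *)

Section Cesaro.
Variables (R : realType) (alpha beta : R) (phi : R * R -> R) (K : R).
Hypotheses (mphi : measurable_fun
    [set: (measurableTypeR R * measurableTypeR R)%type] phi)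
  (pphi : periodic2 phi) (K0 : 0 < K).
Local Notation T1 := (measurableTypeR R).
Local Notation T2 := (measurableTypeR R * measurableTypeR R)%type.
Local Notation la := (@lebesgue_measure R).
Local Notation f := (skew_shift alpha beta).
Implicit Types (w : R * R) (t l : R) (n N : nat).

(** The tent evaluated at time [n] on the orbit of [(w, t)] under [(w, t) |-> (f w, t + phi w)]. *)
Definition visit n w t : R := tent K (t + birkhoff_sum f phi n w).

Definition visits N w t : R := \sum_(0 <= n < N) visit n w t.

Lemma visit_iter i n w t :
  visit i (iter n f w) (t + birkhoff_sum f phi n w) = visit (n + i) w t.
Proof. by rewrite /visit birkhoffD addrA. Qed.

Lemma visits_step N w t : visits N (f w) (t + phi w) = visits N.+1 w t - visit 0 w t.
Proof.
rewrite /visits [in RHS]big_nat_recl//= [RHS]addrC addKr.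
apply: eq_bigr => n _; rewrite -[in RHS]add1n -(visit_iter n 1).
by rewrite /birkhoff_sum big_nat1.
Qed.

Lemma visit_ge0 n w t : 0 <= visit n w t. Proof. exact: tent_ge0. Qed.

Lemma visit_le1 n w t : visit n w t <= 1. Proof. exact: tent_le1. Qed.

Lemma visits_le N w t : visits N w t <= N%:R.
Proof.
apply: (@le_trans _ _ (\sum_(0 <= n < N) 1)); first by apply: ler_sum => n _; exact: visit_le1.
by rewrite sumr_const_nat subn0.
Qed.

Lemma visits_lip N w s t : visits N w s <= visits N w t + N%:R * (`|s - t| / K).
Proof.
have -> : N%:R * (`|s - t| / K) = \sum_(0 <= n < N) (`|s - t| / K).
  by rewrite sumr_const_nat subn0 mulr_natl.
rewrite -big_split/=; apply: ler_sum => n _.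
apply: le_trans (tent_lip K0 _ (t + birkhoff_sum f phi n w)) _.
by rewrite opprD addrACA subrr addr0.
Qed.

Lemma birkhoff_periodic n : periodic2 (birkhoff_sum f phi n).
Proof.
move=> x y; rewrite /birkhoff_sum; split; apply: eq_bigr => i _;
  by have [? ?] := periodic2_iter alpha beta i x y pphi.
Qed.

Lemma measurable_iter n : measurable_fun [set: T2] (iter n f : T2 -> T2).
Proof.
have mh : measurable_fun [set: T1] (fun x : R => n%:R * x + (iter n f (0, 0)).2).
  by apply: measurable_funD => //; exact: measurable_funM.
have -> : iter n f = (fun z => (z.1 + n%:R * alpha, z.2 + (n%:R * z.1 + (iter n f (0, 0)).2))).
  by apply/funext => z; rewrite addrA [in LHS]iter_skew.
exact: (measurable_fun_skew (n%:R * alpha) mh).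
Qed.

Lemma measurable_birkhoff n : measurable_fun [set: T2] (birkhoff_sum f phi n).
Proof.
rewrite /birkhoff_sum; apply: measurable_sum => i.
exact: (measurableT_comp mphi (measurable_iter i)).
Qed.

Lemma measurable_visit n : measurable_fun [set: T2 * T1] (fun p => visit n p.1 p.2).
Proof.
apply: (measurableT_comp (tent_measurable K)).
apply: measurable_funD; first exact: measurable_snd.
by apply: (measurableT_comp (measurable_birkhoff n)); exact: measurable_fst.
Qed.

Lemma measurable_visits N : measurable_fun [set: T2 * T1] (fun p => visits N p.1 p.2).
Proof. by apply: measurable_sum => n; exact: measurable_visit. Qed.

(** The upper limit of [visits N w t / N] exceeds [l]. The strict gap up to [mu] absorbs bounded
    errors in the count and small changes of [t]. *)
Definition recurrent l w t := exists2 mu, l < mu &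
  forall M, exists2 N, (M <= N)%N & mu * N%:R <= visits N w t.

(** Moving the time by one changes the length of the window by one and the count by at most 1; both
    are negligible against [(mu - mu') * N] for large [N]. *)
Lemma recurrent_step l w t : 0 <= l -> recurrent l (f w) (t + phi w) <-> recurrent l w t.
Proof.
move=> l0; split=> -[mu lmu H].
  pose mu' := (l + mu) / 2.
  have [m1 m2] : l < mu' /\ mu' < mu by rewrite /mu'; split; lra.
  have mm : 0 < mu - mu' by lra.
  exists mu' => // M; have [N MN hN] := H (maxn M (Num.bound (mu' / (mu - mu')))).
  exists N.+1; first by rewrite (leq_trans _ (leqnSn N))// (leq_trans _ MN)// leq_maxl.
  have h : mu' / (mu - mu') <= N%:R.
    apply: (@le_trans _ _ (Num.bound (mu' / (mu - mu')))%:R).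
      by apply/ltW/archi_boundP; rewrite divr_ge0//; lra.
    by rewrite ler_nat (leq_trans _ MN)// leq_maxr.
  rewrite ler_pdivrMr// in h.
  rewrite visits_step in hN; have := visit_ge0 0 w t.
  by rewrite -natr1; lra.
pose mu' := (l + mu) / 2.
have [m1 m2] : l < mu' /\ mu' < mu by rewrite /mu'; split; lra.
have mm : 0 < mu - mu' by lra.
exists mu' => // M; have [N MN hN] := H (maxn M.+1 (Num.bound (mu - mu')^-1).+1).
case: N MN hN => [|N] MN hN; first by move: MN; rewrite leqn0 -leqn0 geq_max.
exists N; first by rewrite -ltnS (leq_trans _ MN)// leq_maxl.
have h : (mu - mu')^-1 <= N%:R.
  apply: (@le_trans _ _ (Num.bound (mu - mu')^-1)%:R).
    by apply/ltW/archi_boundP; rewrite invr_ge0; lra.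
  by rewrite ler_nat -ltnS (leq_trans _ MN)// leq_maxr.
have h' : 1 <= N%:R * (mu - mu') by rewrite -ler_pdivrMr// mul1r.
rewrite visits_step; have := visit_le1 0 w t.
by move: hN; rewrite -natr1; lra.
Qed.

Lemma recurrent_near l l' w s t : recurrent l w t -> `|s - t| / K <= l - l' ->
  recurrent l' w s.
Proof.
move=> [mu lmu H] st; exists (mu - `|s - t| / K); first by lra.
move=> M; have [N MN hN] := H M; exists N => //.
have := visits_lip N w t s; rewrite distrC mulrBl (mulrC _ N%:R); lra.
Qed.

Lemma recurrent_open l w t : recurrent l w t ->
  exists2 r : R, 0 < r & forall s, `|s - t| < r -> recurrent l w s.
Proof.
move=> [mu lmu H]; pose mu' := (l + mu) / 2.
have [m1 m2] : l < mu' /\ mu' < mu by rewrite /mu'; split; lra.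
exists ((mu' - l) * K); first by rewrite mulr_gt0//; lra.
move=> s st; apply: (@recurrent_near mu' _ _ _ t); first by exists mu.
by rewrite ler_pdivrMr// ltW.
Qed.

(** Restricting [mu] to the values [l + 1 / (j + 1)] leaves only countable quantifiers, as
    measurability requires. *)
Lemma recurrentE l w t : recurrent l w t <->
  exists j : nat, forall M, exists2 N, (M <= N)%N &
    (l + j.+1%:R^-1) * N%:R <= visits N w t.
Proof.
split=> [[mu lmu H]|[j H]]; last by exists (l + j.+1%:R^-1); rewrite ?ltrDl.
have mm : 0 < mu - l by lra.
have [j _ hj] := near_infty_natSinv_lt (PosNum mm).
exists j => M; have [N MN hN] := H M; exists N => //.
apply: le_trans hN; apply: ler_wpM2r => //.
by have := hj j (leqnn j); rewrite /=; move: (j.+1%:R^-1) => x; lra.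
Qed.

Lemma measurable_recurrent l t : measurable ([set w | recurrent l w t] : set T2).
Proof.
have -> : [set w | recurrent l w t] = \bigcup_j \bigcap_M \bigcup_(N in [set N | (M <= N)%N])
    [set w | (l + j.+1%:R^-1) * N%:R <= visits N w t].
  apply/seteqP; split => w /=.
    move=> /recurrentE[j H]; exists j => // M _; have [N MN hN] := H M.
    by exists N.
  move=> [j _ H]; apply/recurrentE; exists j => M; have [N MN hN] := H M Logic.I.
  by exists N.
apply: bigcupT_measurable => j; apply: bigcapT_measurable => M.
apply: bigcup_measurable => N _.
have mv := measurable_fun_pair1 t (measurable_visits N).
have := measurable_fun_ler (measurable_cst ((l + j.+1%:R^-1) * N%:R)) mv.
by move=> /(_ measurableT [set true]); rewrite setTI; apply.
Qed.

Lemma recurrent_periodic l x y t :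
  recurrent l (x + 1, y) t = recurrent l (x, y) t /\
  recurrent l (x, y + 1) t = recurrent l (x, y) t.
Proof.
have E w w' : (forall n, birkhoff_sum f phi n w = birkhoff_sum f phi n w') ->
    recurrent l w t = recurrent l w' t.
  move=> ww; have {}ww N : visits N w t = visits N w' t.
    by apply: eq_bigr => n _; rewrite /visit ww.
  by apply/propext; split=> -[mu lmu H]; exists mu => // M;
    have [N MN hN] := H M; exists N; rewrite // ?ww// -ww.
by split; apply: E => n; have [? ?] := birkhoff_periodic n x y.
Qed.

End Cesaro.

(** * The supremum of the recurrent heights as transfer function *)

Section Height.
Variables (R : realType) (alpha beta : R) (phi : R * R -> R) (K : R).
Hypotheses (mphi : measurable_fun
    [set: (measurableTypeR R * measurableTypeR R)%type] phi)
  (pphi : periodic2 phi) (K0 : 0 < K).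
Local Notation T1 := (measurableTypeR R).
Local Notation T2 := (measurableTypeR R * measurableTypeR R)%type.
Local Notation la := (@lebesgue_measure R).
Local Notation f := (skew_shift alpha beta).
Local Notation recurrent := (recurrent alpha beta phi K).
Local Notation visit := (visit alpha beta phi K).
Local Notation visits := (visits alpha beta phi K).
Implicit Types (w : R * R) (t l : R) (n N : nat).

Definition height l w : \bar R := ereal_sup [set t%:E | t in recurrent l w].

Lemma height_step l w : 0 <= l -> height l (f w) = (height l w + (phi w)%:E)%E.
Proof.
move=> l0; apply/le_anti/andP; split.
  apply: ge_ereal_sup => _ [t rt <-].
  rewrite -leeBlDr// -EFinB; apply: ereal_sup_ubound; exists (t - phi w) => //.
  by apply/recurrent_step => //; rewrite subrK.
rewrite -leeBrDr//; apply: ge_ereal_sup => _ [t rt <-].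
rewrite leeBrDr// -EFinD; apply: ereal_sup_ubound; exists (t + phi w) => //.
exact/recurrent_step.
Qed.

Lemma height_periodic l x y :
  height l (x + 1, y) = height l (x, y) /\ height l (x, y + 1) = height l (x, y).
Proof.
by split; rewrite /height; congr (ereal_sup (_ @` _)); apply/funext => t;
  have [? ?] := recurrent_periodic alpha beta K pphi l x y t.
Qed.

(** The recurrent heights form an open set, so a supremum above [c] is detected by a rational
    height. *)
Lemma measurable_height l : measurable_fun [set: T2] (height l).
Proof.
apply: (measurability _ (ErealGenOInfty.measurableE R)) => _ [_ [c ->] <-].
rewrite setTI.
have -> : height l @^-1` `]c%:E, +oo[ =
    \bigcup_(q : rat) ([set w | recurrent l w (ratr q)] `&` [set w | c < ratr q]).
  apply/seteqP; split => w /=.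
    rewrite in_itv/= andbT => /ereal_sup_gt[_ [t rt <-]]; rewrite lte_fin => ct.
    have [r r0 hr] := recurrent_open K0 rt.
    have [q] := @rat_in_itvoo R (Num.max c (t - r)) t ltac:(rewrite gt_max ct/=; lra).
    rewrite in_itv/= gt_max => /andP[/andP[cq rq] qt]; exists q => //; split => //=.
    by apply: hr; rewrite ltr_norml; apply/andP; split; lra.
  move=> [q _ [/= rq cq]]; rewrite in_itv/= andbT.
  apply: (@lt_le_trans _ _ (ratr q)%:E); first by rewrite lte_fin.
  by apply: ereal_sup_ubound; exists (ratr q).
apply: countable_bigcupT_measurable => // q.
apply: measurableI; first exact: measurable_recurrent.
by have [h|h] := boolP (c < ratr q :> R); rewrite ?set_true// ?set_false.
Qed.

Lemma coboundary_of_height l : 0 <= l ->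
  Leb (~` [set w | height l w \is a fin_num]) = 0%E -> measurable_coboundary f phi.
Proof.
move=> l0 L0; exists (fine \o height l); split.
- by move=> x y /=; have [-> ->] := height_periodic l x y.
- by apply: measurableT_comp; [exact: fine_measurable|exact: measurable_height].
have mfin : measurable ([set w | height l w \is a fin_num] : set T2).
  by have := emeasurable_fin_num measurableT (measurable_height l); rewrite setTI.
exists (~` [set w | height l w \is a fin_num]); split => //.
  exact: measurableC.
move=> w /=; apply: contra_not => fw.
by rewrite height_step// fineD//= addrAC subrr add0r.
Qed.

End Height.

(** * The maximal inequality on the real extension *)

Section MaximalInequality.
Variables (R : realType) (alpha beta : R) (phi : R * R -> R) (K l : R).
Hypotheses (mphi : measurable_fun
    [set: (measurableTypeR R * measurableTypeR R)%type] phi)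
  (pphi : periodic2 phi) (K0 : 0 < K) (l0 : 0 < l).
Local Notation T1 := (measurableTypeR R).
Local Notation T2 := (measurableTypeR R * measurableTypeR R)%type.
Local Notation la := (@lebesgue_measure R).
Local Notation f := (skew_shift alpha beta).
Local Notation visit := (visit alpha beta phi K).
Local Notation visits := (visits alpha beta phi K).
Local Open Scope ereal_scope.
Implicit Types (w : R * R) (t : R) (n N L : nat).

(** Windows are truncated at length [L] so that the finite covering argument applies; the truncation
    is lifted in [ae_often_finite]. *)
Definition often L : set ((R * R) * R) :=
  [set p | exceeds (fun i => visit i p.1 p.2) l L 0].

Lemma oftenP L w t : often L (w, t) <->
  exists2 N, (0 < N <= L)%N & (l * N%:R <= visits N w t)%R.
Proof.
split=> [/existsP[N hN]|[[|N]// /andP[_ NL] hN]].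
  by exists N.+1 => //; rewrite ltn_ord.
by apply/existsP; exists (Ordinal NL).
Qed.

Lemma measurable_often L : measurable (often L : set (T2 * T1)).
Proof.
have -> : often L = \bigcup_(N in [set N | (0 < N <= L)%N])
    [set p | (l * N%:R <= visits N p.1 p.2)%R].
  apply/seteqP; split => [[w t]/oftenP[N ? ?]|[w t] [N /= NL ?]]; first by exists N.
  by apply/oftenP; exists N.
apply: bigcup_measurable => N _.
have mv := measurable_visits alpha beta K mphi N.
have := measurable_fun_ler (measurable_cst (l * N%:R)%R) mv.
by move=> /(_ measurableT [set true]); rewrite setTI; apply.
Qed.

Let g L w := \int[la]_t (\1_(often L) (w, t))%:E.

Let mind L : measurable_fun [set: T2 * T1] (fun p => (\1_(often L) p)%:E : \bar R).
Proof. by apply/measurable_EFinP; apply: measurable_indic; exact: measurable_often. Qed.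

Let mg L : measurable_fun [set: T2] (g L).
Proof.
by apply: (measurable_fun_integral_dom la measurableT (mind L)) => z; rewrite lee_fin.
Qed.

Let g0 L w : 0 <= g L w.
Proof. by apply: integral_ge0 => t _; rewrite lee_fin. Qed.

Let often_iter L n w t :
  \1_(often L) (iter n f w, (t + birkhoff_sum f phi n w)%R) =
  (exceeds (fun i => visit i w t) l L n)%:R :> R.
Proof.
rewrite indicE; congr ((nat_of_bool _)%:R); rewrite /often mem_setE/= /exceeds.
apply: eq_existsb => N; congr (_ <= _)%R.
have := @big_addn _ 0%R +%R 0%N (n + N.+1) n xpredT (fun i => visit i w t).
rewrite add0n addKn => ->; rewrite add0n.
by apply: eq_bigr => i _; rewrite visit_iter addnC.
Qed.

Let g_iter L n w : g L (iter n f w) =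
  \int[la]_t (exceeds (fun i => visit i w t) l L n)%:R%:E.
Proof.
rewrite /g -(ge0_integral_shift (birkhoff_sum f phi n w) (D := setT)
  (g := fun t => (\1_(often L) (iter n f w, t))%:E))//.
  by apply: eq_integral => t _; rewrite often_iter.
exact: (measurable_fun_pair2 _ (mind L)).
Qed.

(** [maximal_counting] with [T = L], integrated over [t]. Translation invariance in [t] identifies
    the left side with values of [g] along the orbit and bounds each of the [L + L] visits by the
    integral of the tent. *)
Let g_sum L w : \sum_(0 <= n < L) (l%:E * g L (iter n f w)) <= ((L + L)%:R * (2 * K))%:E.
Proof.
have mex n : measurable_fun [set: T1]
    (fun t => (exceeds (fun i => visit i w t) l L n)%:R%:E : \bar R).
  have -> : (fun t => (exceeds (fun i => visit i w t) l L n)%:R%:E : \bar R) =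
     (fun t => (\1_(often L) (iter n f w, (t + birkhoff_sum f phi n w)%R))%:E).
    by apply/funext => t; rewrite often_iter.
  have ms : measurable_fun [set: T1] ((fun t => (t + birkhoff_sum f phi n w)%R) : T1 -> T1).
    exact: measurable_funD.
  exact: (measurableT_comp (measurable_fun_pair2 (iter n f w) (mind L)) ms).
have mvi n : measurable_fun [set: T1] (fun t => (visit n w t)%:E).
  apply/measurable_EFinP.
  exact: (measurable_fun_pair2 w (measurable_visit alpha beta K mphi n)).
apply: (@le_trans _ _ (\int[la]_t \sum_(0 <= n < L)
    (l%:E * (exceeds (fun i => visit i w t) l L n)%:R%:E))).
  rewrite ge0_integral_sum//; last 2 first.
  - by move=> n; exact: measurable_funeM.
  - by move=> n t _; rewrite mule_ge0// lee_fin// ltW.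
  apply: lee_sum => n _; rewrite g_iter ge0_integralZl// ?lee_fin ?ltW//.
apply: (@le_trans _ _ (\int[la]_t \sum_(0 <= i < L + L) (visit i w t)%:E)).
  apply: ge0_le_integral => //.
  - by move=> t _; apply: sume_ge0 => n _; rewrite mule_ge0// lee_fin// ltW.
  - by apply: emeasurable_sum => n; exact: measurable_funeM.
  - by apply: emeasurable_sum.
  - move=> t _; under eq_bigr do rewrite -EFinM.
    rewrite !sumEFin lee_fin -mulr_sumr.
    have := @maximal_counting R (fun i => visit i w t) l L
      (fun i => visit_ge0 _ _ _ _ _ _ _) (ltW l0) L 0%N.
    by rewrite add0n.
rewrite ge0_integral_sum//; last by move=> n t _; rewrite lee_fin visit_ge0.
apply: (@le_trans _ _ (\sum_(0 <= i < L + L) (2 * K)%:E)).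
  apply: lee_sum => n _; apply: le_trans (integral_tent K0).
  rewrite -(ge0_integral_shift (birkhoff_sum f phi n w) (D := setT)
    (g := fun t => (tent K t)%:E))//.
  - by apply/measurable_EFinP; exact: tent_measurable.
  - by move=> t; rewrite lee_fin tent_ge0.
by rewrite sumEFin sumr_const_nat subn0 (mulr_natl (2 * K)%R).
Qed.

(** By invariance of [Leb], all terms of [g_sum] have the same integral [I], so that l L I <= 2 L *
    2 K and the length [L] cancels. *)
Lemma often_integral L : \int[Leb]_w g L w <= (4 * K / l)%:E.
Proof.
case: L => [|L].
  rewrite integral0_eq ?lee_fin; first by rewrite divr_ge0 ?mulr_ge0// ltW.
  move=> w _; apply: integral0_eq => t _; rewrite indicE memNset//.
  by move=> /oftenP[N]; case: N.
have gper x y : g L.+1 (x + 1, y)%R = g L.+1 (x, y) /\ g L.+1 (x, y + 1)%R = g L.+1 (x, y).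
  by split; apply: eq_integral => t _; rewrite !indicE; congr ((nat_of_bool _)%:R)%:E;
    apply/idP/idP; rewrite !inE => /oftenP[N NL hN]; apply/oftenP; exists N => //;
    move: hN; congr (_ <= _)%R; apply: eq_bigr => n _;
    have [E1 E2] := birkhoff_periodic alpha beta pphi n x y; rewrite /visit ?E1 ?E2.
have gint n : \int[Leb]_w g L.+1 (iter n f w) = \int[Leb]_w g L.+1 w.
  have mh : measurable_fun [set: T1] (fun x : R => n%:R * x + (iter n f (0, 0)).2)%R.
    by apply: measurable_funD => //; exact: measurable_funM.
  rewrite -(integral_Leb_skew (n%:R * alpha) mh (mg L.+1) (g0 L.+1) gper).
  by apply: eq_integral => w _; rewrite [in LHS]iter_skew addrA.
have mgi n : measurable_fun [set: T2] (fun w => g L.+1 (iter n f w)).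
  exact: (measurableT_comp (mg L.+1) (measurable_iter alpha beta n)).
have : \int[Leb]_w \sum_(0 <= n < L.+1) (l%:E * g L.+1 (iter n f w)) <=
    \int[Leb]_w ((L.+1 + L.+1)%:R * (2 * K))%:E.
  apply: ge0_le_integral => //.
  - by move=> w _; apply: sume_ge0 => n _; rewrite mule_ge0// lee_fin ltW.
  - by apply: emeasurable_sum => n; exact: measurable_funeM.
rewrite integral_cst// [X in (_ * X)]Leb_setT mule1.
rewrite ge0_integral_sum//; last 2 first.
- by move=> n; exact: measurable_funeM.
- by move=> n w _; rewrite mule_ge0// lee_fin ltW.
under eq_bigr => n _ do rewrite ge0_integralZl ?lee_fin ?(ltW l0)// gint.
(* An infinite integral is excluded before the common factor is cancelled in [R]. *)
have [I0 | I0] : \int[Leb]_w g L.+1 w = +oo \/ \int[Leb]_w g L.+1 w \is a fin_num.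
  have : 0 <= \int[Leb]_w g L.+1 w by exact: integral_ge0.
  by case: (\int[Leb]_w g L.+1 w) => [r _|_|//]; [right|left].
  rewrite I0 big_nat_recr//= gt0_muley ?lte_fin// addey.
    by rewrite leye_eq.
  rewrite -ltNye; apply: lt_le_trans (_ : 0 <= _); first by rewrite ltNye.
  by apply: sume_ge0 => n _; rewrite ?leey.
rewrite -(fineK I0); under eq_bigr do rewrite -EFinM.
rewrite sumEFin !lee_fin sumr_const_nat subn0 natrD -(mulr_natl (l * fine _)%R).
rewrite ler_pdivlMr//.
have L0 : (0 < L.+1%:R :> R)%R by [].
move: (L.+1%:R)%R L0 => x x0 H.
rewrite -(ler_pM2l x0); lra.
Qed.

(** The bound of [often_integral] is uniform in [L] and passes to the increasing union [D]; by
    Tonelli almost every section of [D] has finite length. *)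
Lemma ae_often_finite :
  {ae Leb, forall w, la [set t | exists L, often L (w, t)] < +oo}.
Proof.
pose D := \bigcup_L often L.
have DE w t : D (w, t) <-> exists L, often L (w, t).
  by split=> [[L _ ?]|[L ?]]; exists L.
have mD : measurable (D : set (T2 * T1)).
  by apply: bigcupT_measurable => L; exact: measurable_often.
have mDw w : measurable ([set t | exists L, often L (w, t)] : set T1).
  have := pair1_measurable w measurableT mD; rewrite setTI.
  rewrite (_ : _ @^-1` _ = [set t | exists L, often L (w, t)])//.
  by apply/seteqP; split => t /DE.
pose W w := \int[la]_t (\1_D (w, t))%:E.
have mindD : measurable_fun [set: T2 * T1] (fun p => (\1_D p)%:E : \bar R).
  by apply/measurable_EFinP; exact: measurable_indic.
have WE w : W w = la [set t | exists L, often L (w, t)].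
  rewrite -[X in _ = la X]setIT -[RHS](integral_indic la measurableT (mDw w)).
  apply: eq_integral => t _.
  rewrite !indicE; congr ((nat_of_bool _)%:R)%:E.
  by apply/idP/idP; rewrite !inE => /DE.
have mW : measurable_fun [set: T2] W.
  by apply: (measurable_fun_integral_dom la measurableT mindD) => z; rewrite lee_fin.
have W0 w : 0 <= W w by apply: integral_ge0 => t _; rewrite lee_fin.
pose nu := (torus_probability R \x la).
have nuE (A : set ((R * R) * R)) : measurable (A : set (T2 * T1)) ->
    nu A = \int[Leb]_w \int[la]_t (\1_A (w, t))%:E.
  move=> mA; rewrite -[X in nu X]setIT -[LHS](integral_indic nu measurableT mA).
  rewrite fubini_tonelli1//.
  by apply/measurable_EFinP; exact: measurable_indic.
have nuD : nu D <= (4 * K / l)%:E.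
  have nd : nondecreasing_seq (often : nat -> set ((R * R) * R)).
    move=> m n mn; apply/subsetPset => -[w t] /oftenP[N /andP[N0 Nm] hN].
    by apply/oftenP; exists N => //; rewrite N0 (leq_trans Nm).
  have := nondecreasing_cvg_mu (mu := nu) measurable_often mD nd.
  move=> cv; apply: (cvge_to_le cv); apply: nearW => L.
  by rewrite [leLHS](nuE _ (measurable_often L)); exact: often_integral.
have iW : Leb.-integrable [set: T2] W.
  apply/integrableP; split => //; apply: le_lt_trans (ltry (4 * K / l)).
  apply: le_trans nuD; rewrite nuE//.
  by under eq_integral do rewrite gee0_abs//.
have := integrable_ae measurableT iW; apply: filterS => w /(_ Logic.I).
by rewrite WE ge0_fin_numE.
Qed.

End MaximalInequality.

(** * From Cesaro recurrence to a coboundary *)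

Section CesaroCoboundary.
Variables (R : realType) (alpha beta : R) (phi : R * R -> R) (K : R).
Hypotheses (mphi : measurable_fun
    [set: (measurableTypeR R * measurableTypeR R)%type] phi)
  (pphi : periodic2 phi) (K0 : 0 < K).
Local Notation T1 := (measurableTypeR R).
Local Notation T2 := (measurableTypeR R * measurableTypeR R)%type.
Local Notation la := (@lebesgue_measure R).
Local Notation f := (skew_shift alpha beta).
Local Notation recurrent := (recurrent alpha beta phi K).
Local Notation often := (often alpha beta phi K).
Local Notation visit := (visit alpha beta phi K).
Local Notation visits := (visits alpha beta phi K).
Local Notation height := (height alpha beta phi K).
Implicit Types (w : R * R) (t l : R) (n N : nat).

Lemma recurrent_often l w t : recurrent l w t -> exists L, often l L (w, t).
Proof.
move=> [mu lmu /(_ 1%N)[N N1 hN]]; exists N; apply/oftenP.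
exists N; first by rewrite N1 leqnn.
by apply: le_trans hN; rewrite ler_wpM2r// ltW.
Qed.

(** Every recurrent height [t] brings an interval of length [rho] into [D]. As [D] has finite
    length, its part beyond some [m] is shorter than [rho], so no recurrent height exceeds [m]. *)
Lemma recurrent_bounded l w : 0 < l ->
  (la [set t | exists L, often (l / 2) L (w, t)] < +oo)%E ->
  exists b, forall t, recurrent l w t -> t <= b.
Proof.
move=> l0 fin; set D := [set t | _] in fin.
have mD : measurable (D : set T1).
  have -> : D = \bigcup_L [set t | often (l / 2) L (w, t)].
    by apply/seteqP; split => t /= [L] => [?|_ ?]; exists L.
  apply: bigcupT_measurable => L.
  have := pair1_measurable w measurableT (measurable_often alpha beta K (l / 2) mphi L).
  by rewrite setTI.
pose F m := D `&` `[m%:R, +oo[%classic.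
have mF m : measurable (F m : set T1) by apply: measurableI => //; exact: measurable_itv.
have F0 : \bigcap_m F m = set0.
  apply/seteqP; split => // t Ft.
  have := Ft (Num.bound t) Logic.I; rewrite /F/= in_itv/= andbT => -[_] h.
  have := le_lt_trans (le_trans h (ler_norm t)) (archi_boundP (normr_ge0 t)).
  by rewrite /Num.bound normr_id ltxx.
have Ffin : (la (F 0%N) < +oo)%E.
  by apply: le_lt_trans fin; apply: le_measure; rewrite ?inE// => t [].
have niF : nonincreasing_seq F.
  move=> m n mn; apply/subsetPset => t [Dt]; rewrite /= !in_itv/= !andbT => nt.
  by split => //=; rewrite in_itv/= andbT (le_trans _ nt)// ler_nat.
have mF0 : measurable ((\bigcap_m F m) : set T1) by rewrite F0.
have := nonincreasing_cvg_mu (mu := la) Ffin mF mF0 niF.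
rewrite F0 measure0 => cv.
(* The tent has Lipschitz constant [1 / K], so a shift by less than [rho] lowers the frequency by at
   most [l / 2]. *)
pose rho := l / 2 * K; have rho0 : 0 < rho by rewrite mulr_gt0// divr_gt0.
have [m hm] : exists m, (la (F m) < rho%:E)%E.
  apply: contrapT => nex; have : (rho%:E <= 0)%E.
    apply: (cvge_to_ge cv); apply: nearW => m /=; rewrite leNgt; apply/negP => h.
    by apply: nex; exists m.
  by rewrite lee_fin leNgt rho0.
exists m%:R => t rt; rewrite leNgt; apply/negP => mt.
move: hm; rewrite ltNge => /negP; apply.
apply: (@le_trans _ _ (la `[t, (t + rho)%R])).
  by rewrite lebesgue_measure_itv/= lte_fin ltrDl rho0 -EFinD lee_fin addrAC subrr add0r.
apply: le_measure; rewrite ?inE//.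
move=> s /=; rewrite in_itv/= => /andP[ts sr]; split.
  apply: recurrent_often; apply: (recurrent_near K0 rt).
  by rewrite ger0_norm ?subr_ge0// ler_pdivrMr// -/rho; move: sr; rewrite /rho; lra.
by rewrite /= in_itv/= andbT (le_trans (ltW mt)).
Qed.

(** The tent is at least 1/2 where the Birkhoff sum is below [K / 2], so [visits N] has mean at
    least [d / 2 * N]. Being at most [N], it reaches [d / 4 * N] with probability at least [d / 4],
    and this bound survives in the upper limit of the sets. Level [d / 8] leaves the strict gap that
    [recurrent] demands. *)
Lemma recurrent_positive d : 0 < d ->
  (forall N, ((d * N%:R)%:E <=
    \sum_(0 <= n < N) Leb [set z | (`|birkhoff_sum f phi n z| < K / 2)%R])%E) ->
  ((d / 4)%:E <= Leb [set w | recurrent (d / 8) w 0])%E.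
Proof.
move=> d0 H.
pose G N := [set w | d / 4 * N%:R <= visits N w 0].
have mv N := measurable_fun_pair1 (0 : R) (measurable_visits alpha beta K mphi N).
have mG N : measurable (G N : set T2).
  have := measurable_fun_ler (measurable_cst (d / 4 * N%:R)%R) (mv N).
  by move=> /(_ measurableT [set true]); rewrite setTI; apply.
have mB n : measurable ([set z | `|birkhoff_sum f phi n z| < K / 2] : set T2).
  by apply: measurable_lt; exact: measurable_birkhoff.
have GN N : ((d / 4)%:E <= Leb (G N.+1))%E.
  have N0 : 0 < N.+1%:R :> R by [].
  have low : ((d / 2 * N.+1%:R)%:E <= \int[Leb]_w (visits N.+1 w 0)%:E)%E.
    apply: (@le_trans _ _ (\sum_(0 <= n < N.+1) ((2^-1)%:E *
        Leb [set z | (`|birkhoff_sum f phi n z| < K / 2)%R]))%E).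
      rewrite -ge0_sume_distrr//.
      apply: le_trans (lee_wpmul2l _ (H N.+1)); last by rewrite lee_fin.
      by rewrite -EFinM lee_fin le_eqVlt; apply/orP; left; apply/eqP; ring.
    under [leRHS]eq_integral do rewrite -sumEFin.
    rewrite ge0_integral_sum//; last 2 first.
    - move=> n; apply/measurable_EFinP.
      exact: measurable_fun_pair1 (measurable_visit alpha beta K mphi n).
    - by move=> n w _; rewrite lee_fin visit_ge0.
    apply: lee_sum => n _; rewrite Leb_indic// -ge0_integralZl//; last first.
      by apply/measurable_EFinP; exact: measurable_indic.
    apply: ge0_le_integral => //.
    - apply: measurable_funeM.
      by apply/measurable_EFinP; exact: measurable_indic.
    - by apply/measurable_EFinP; exact: measurable_fun_pair1 (measurable_visit alpha beta K mphi n).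
    - move=> w _; rewrite -EFinM lee_fin indicE.
      have [|_] := boolP (w \in _); last by rewrite mulr0 visit_ge0.
      by rewrite inE/= mulr1 => hw; rewrite /visit add0r tent_half.
  have up : (\int[Leb]_w (visits N.+1 w 0)%:E <=
      N.+1%:R%:E * Leb (G N.+1) + (d / 4 * N.+1%:R)%:E)%E.
    apply: (@le_trans _ _ (\int[Leb]_w (N.+1%:R%:E * (\1_(G N.+1) w)%:E +
        (d / 4 * N.+1%:R)%:E))%E).
      apply: ge0_le_integral => //.
      - by move=> w _; rewrite lee_fin; apply: sumr_ge0 => n _; exact: visit_ge0.
      - by apply/measurable_EFinP; exact: mv.
      - apply: emeasurable_funD => //; apply: measurable_funeM.
        by apply/measurable_EFinP; exact: measurable_indic.
      - move=> w _; rewrite -EFinM -EFinD lee_fin indicE.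
        have [_|] := boolP (w \in _).
          rewrite mulr1; apply: le_trans (visits_le _ _ _ K0 _ _ _) _.
          by rewrite lerDl mulr_ge0// divr_ge0// ltW.
        rewrite mulr0 add0r => /negP wG; rewrite leNgt; apply/negP => h.
        by apply: wG; rewrite inE /G/= ltW.
    rewrite ge0_integralD//; last 2 first.
    - apply: measurable_funeM.
      by apply/measurable_EFinP; exact: measurable_indic.
    - by move=> w _; rewrite lee_fin mulr_ge0// divr_ge0// ltW.
    rewrite integral_cst// [X in (_ * X)%E]Leb_setT mule1.
    rewrite ge0_integralZl//; last by apply/measurable_EFinP; exact: measurable_indic.
    by rewrite -Leb_indic.
  have := le_trans low up.
  have [r ->] : exists r, Leb (G N.+1) = r%:E.
    exists (fine (Leb (G N.+1))); rewrite fineK// ge0_fin_numE//.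
    apply: le_lt_trans (ltry (1 : R)); rewrite -(Leb_setT R).
    by apply: le_measure; rewrite ?inE.
  rewrite -EFinM -EFinD !lee_fin; move: (N.+1%:R) N0 => x x0 h.
  by rewrite -(ler_pM2l x0); lra.
pose F N := G N.+1.
have mF N : measurable (F N : set T2) by exact: mG.
have LebU n : (Leb (\bigcup_(k in [set k | (n <= k)%N]) F k) < +oo)%E.
  apply: le_lt_trans (ltry (1 : R)); rewrite -(Leb_setT R).
  by apply: le_measure; rewrite ?inE//; exact: bigcup_measurable.
have cv := lim_sup_set_cvg Leb F mF (LebU 0%N).
apply: (@le_trans _ _ (Leb (lim_sup_set F))).
  apply: (cvge_to_ge cv); apply: nearW => n.
  apply: le_trans (GN n) _; apply: le_measure; rewrite ?inE//.
    exact: bigcup_measurable.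
  by move=> w Gw; exists n => //=.
apply: le_measure; rewrite ?inE//.
- by apply: bigcap_measurable => // k _; exact: bigcup_measurable.
- exact: measurable_recurrent.
- move=> w lw; exists (d / 4); first by lra.
  move=> M; have [N /= MN hN] := lw M Logic.I.
  by exists N.+1 => //; exact: leqW.
Qed.

(** Finiteness of the height is invariant, so by ergodicity it only has to be non-null. Almost every
    [w] for which 0 is recurrent has a nonempty bounded set of recurrent heights, and such [w] have
    positive measure. *)
Lemma coboundary_of_cesaro d : irrational alpha -> 0 < d ->
  (forall N, ((d * N%:R)%:E <=
    \sum_(0 <= n < N) Leb [set z | (`|birkhoff_sum f phi n z| < K / 2)%R])%E) ->
  measurable_coboundary f phi.
Proof.
move=> ialpha d0 H; have l0 : 0 < d / 8 by lra.
apply: (@coboundary_of_height R alpha beta phi K mphi pphi K0 (d / 8) (ltW l0)).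
set E := [set w | height (d / 8) w \is a fin_num].
have mE : measurable (E : set T2).
  have := emeasurable_fin_num measurableT (measurable_height alpha beta mphi K0 (d / 8)).
  by rewrite setTI.
have pE : periodic_set E.
  by move=> x y; rewrite /E/=; have [-> ->] := height_periodic alpha beta K pphi (d / 8) x y.
have fE w : E (f w) = E w.
  by rewrite /E/= height_step ?(ltW l0)// fin_numD andbT.
have [E0|//] := skew_shift_ergodic ialpha mE pE fE.
have l2 : 0 < d / 8 / 2 by lra.
have [N [mN N0 hN]] := ae_often_finite alpha beta mphi pphi K0 l2.
have := recurrent_positive d0 H; rewrite leNgt => /negP; case.
apply: (@le_lt_trans _ _ 0%E); last by rewrite lte_fin; lra.
rewrite -(adde0 0%E) -[X in (_ <= X + _)%E]E0 -[X in (_ <= _ + X)%E]N0.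
apply: le_trans (measureU2 _ mE mN).
apply: le_measure; rewrite ?inE//; first exact: measurable_recurrent.
  exact: measurableU.
move=> w /= rw; have [wN|wN] := pselect (N w); [by right|left].
have fin : (la [set t | exists L, often (d / 8 / 2) L (w, t)] < +oo)%E.
  by apply: contrapT => /hN.
have [b hb] := recurrent_bounded l0 fin.
rewrite /E/= fin_numE; apply/andP; split.
  rewrite -ltNye; apply: lt_le_trans (ereal_sup_ubound (ex_intro2 _ _ 0 rw erefl)).
  exact: ltNyr.
rewrite -ltey; apply: le_lt_trans (ltry b).
by apply: ge_ereal_sup => _ [t /hb tb <-]; rewrite lee_fin.
Qed.

End CesaroCoboundary.

(** * The second-moment argument *)

Section SecondMoment.
Variable R : realType.
Local Notation T2 := (measurableTypeR R * measurableTypeR R)%type.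

(** With truncated subtraction [(m - i) + (i - m)] is the distance |m - i|, and each distance is
    taken at most twice. *)
Lemma sum_dist_le (p : nat -> R) M m : (forall r, 0 <= p r) -> (m < M)%N ->
  \sum_(0 <= i < M) p ((m - i) + (i - m))%N <= 2 * \sum_(0 <= r < M) p r.
Proof.
move=> p0 mM; rewrite (@big_cat_nat _ _ _ m.+1)//= mulr_natl mulr2n.
apply: lerD.
  have -> : \sum_(0 <= i < m.+1) p ((m - i) + (i - m))%N = \sum_(0 <= i < m.+1) p i.
    rewrite big_nat_rev/= [LHS]big_nat [RHS]big_nat.
    apply: eq_bigr => i; rewrite ltnS => /andP[_ im]; congr p.
    by rewrite add0n subSS subKn// (eqP (_ : (m - i - m == 0)%N)) ?addn0// subn_eq0 leq_subr.
  by rewrite [leRHS](@big_cat_nat _ _ _ m.+1)//= lerDl sumr_ge0.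
have -> : \sum_(m.+1 <= i < M) p ((m - i) + (i - m))%N = \sum_(1 <= i < M - m) p i.
  rewrite -(add1n m) big_addn [LHS]big_nat [RHS]big_nat.
  by apply: eq_bigr => i _; congr p; rewrite addnK (eqP (_ : (m - (i + m) == 0)%N)) ?add0n// subn_eq0 leq_addl.
have M0 : (0 < M - m)%N by rewrite subn_gt0.
apply: (@le_trans _ _ (\sum_(0 <= i < M - m) p i)).
  by rewrite [leRHS](@big_cat_nat _ _ _ 1)//= lerDr sumr_ge0.
by rewrite [leRHS](@big_cat_nat _ _ _ (M - m))//= ?leq_subr// lerDl sumr_ge0.
Qed.

Lemma Leb_fin (S : set (R * R)) : measurable (S : set T2) -> Leb S \is a fin_num.
Proof.
move=> mS; rewrite ge0_fin_numE//; apply: le_lt_trans (ltry (1 : R)).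
by rewrite -(Leb_setT R); apply: le_measure; rewrite ?inE.
Qed.

(** With [Y] counting the sets that contain [z], integrate 2 t Y <= Y^2 + t^2 at [t = e * M], a
    lower bound for the mean of [Y]; this replaces Cauchy-Schwarz. *)
Lemma second_moment (B : nat -> set (R * R)) (e : R) M :
  (forall m, measurable (B m : set T2)) -> 0 <= e -> (forall m, e%:E <= Leb (B m))%E ->
  (e * M%:R) ^+ 2 <= \sum_(0 <= m < M) \sum_(0 <= k < M) fine (Leb (B m `&` B k)).
Proof.
move=> mB e0 eB; pose t := e * M%:R.
have t0 : 0 <= t by rewrite mulr_ge0.
pose Y z : R := \sum_(0 <= m < M) \1_(B m) z.
have Y0 z : 0 <= Y z by apply: sumr_ge0.
have mI m : measurable_fun [set: T2] (\1_(B m) : T2 -> R) by exact: measurable_indic.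
have mY : measurable_fun [set: T2] Y by exact: measurable_sum.
have pw z : 2 * t * Y z <= Y z ^+ 2 + t ^+ 2 by have := sqr_ge0 (Y z - t); rewrite sqrrB; lra.
have : (\int[Leb]_z (2 * t * Y z)%:E <= \int[Leb]_z (Y z ^+ 2 + t ^+ 2)%:E)%E.
  apply: ge0_le_integral => //.
  - by move=> z _; rewrite lee_fin mulr_ge0// mulr_ge0.
  - by apply/measurable_EFinP; exact: measurable_funM.
  - by apply/measurable_EFinP; apply: measurable_funD => //; exact: measurable_funX.
  - by move=> z _; rewrite lee_fin.
have -> : (\int[Leb]_z (2 * t * Y z)%:E = (2 * t)%:E * \sum_(0 <= m < M) Leb (B m))%E.
  under eq_integral do rewrite EFinM.
  rewrite ge0_integralZl//; last 3 first.
  - exact/measurable_EFinP.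
  - by move=> z _; rewrite lee_fin.
  - by rewrite lee_fin mulr_ge0.
  congr (_ * _)%E; under eq_integral do rewrite -sumEFin.
  rewrite ge0_integral_sum//; last by move=> m; exact/measurable_EFinP.
  by apply: eq_bigr => m _; rewrite -Leb_indic.
have -> : (\int[Leb]_z (Y z ^+ 2 + t ^+ 2)%:E =
    \sum_(0 <= m < M) \sum_(0 <= k < M) Leb (B m `&` B k) + (t ^+ 2)%:E)%E.
  under eq_integral do rewrite EFinD.
  rewrite ge0_integralD//; last 3 first.
  - by move=> z _; rewrite lee_fin sqr_ge0.
  - by apply/measurable_EFinP; exact: measurable_funX.
  - by move=> z _; rewrite lee_fin sqr_ge0.
  rewrite integral_cst// [X in (_ + _ * X)%E]Leb_setT mule1; congr (_ + _)%E.
  have YE z : Y z ^+ 2 = \sum_(0 <= m < M) \sum_(0 <= k < M) \1_(B m `&` B k) z.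
    rewrite expr2 {1}/Y mulr_suml; apply: eq_bigr => m _.
    by rewrite mulr_sumr; apply: eq_bigr => k _; rewrite indicI.
  under eq_integral do rewrite YE -sumEFin.
  have mII m k : measurable_fun [set: T2] (fun z => (\1_(B m `&` B k) z)%:E : \bar R).
    by apply/measurable_EFinP; apply: measurable_indic; exact: measurableI.
  rewrite ge0_integral_sum//; last 2 first.
  - by move=> m; under eq_fun do rewrite -sumEFin; exact: emeasurable_sum.
  - by move=> m z _; rewrite lee_fin sumr_ge0.
  apply: eq_bigr => m _; under eq_integral do rewrite -sumEFin.
  rewrite ge0_integral_sum//.
  by apply: eq_bigr => k _; rewrite -Leb_indic//; exact: measurableI.
have -> : (\sum_(0 <= m < M) \sum_(0 <= k < M) Leb (B m `&` B k) =
   (\sum_(0 <= m < M) \sum_(0 <= k < M) fine (Leb (B m `&` B k)))%:E)%E.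
  rewrite -sumEFin; apply: eq_bigr => m _; rewrite -sumEFin; apply: eq_bigr => k _.
  by rewrite fineK// Leb_fin//; exact: measurableI.
have low : ((2 * t)%:E * t%:E <= (2 * t)%:E * \sum_(0 <= m < M) Leb (B m))%E.
  apply: lee_wpmul2l; first by rewrite lee_fin mulr_ge0.
  have -> : t%:E = (\sum_(0 <= m < M) e%:E)%E.
    by rewrite sumEFin sumr_const_nat subn0 /t mulr_natr.
  by apply: lee_sum.
move=> /(le_trans low); rewrite -EFinM -EFinD lee_fin -/t !expr2; lra.
Qed.

End SecondMoment.

(** * Boundedness on average for the Birkhoff sums of the oscillation *)

Section Main.
Variables (R : realType) (alpha beta : R).
Local Notation T1 := (measurableTypeR R).
Local Notation T2 := (measurableTypeR R * measurableTypeR R)%type.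
Local Notation la := (@lebesgue_measure R).
Local Notation f := (skew_shift alpha beta).

Lemma admissible_vosc (Phi : R * R -> R) : class_R Phi ->
  exists d, admissible d (vosc Phi).
Proof.
move=> [[d _ [pPhi cPhi tPhi]] [d' /trig_poly_homtrig tm]].
have hPhi x := trig_poly_homtrig (tPhi x).
exists d; split.
- move=> z; apply: cvgB; first exact: cPhi.
  apply: (continuous_comp (f := fst)); first exact: cvg_fst.
  exact: (homtrig_continuous tm).
- move=> x y; rewrite /vosc/= /vmean (pPhi x y).2; split => //.
  rewrite (pPhi x y).1; congr (_ - _); apply: eq_Rintegral => t _.
  by rewrite (pPhi x t).1.
- move=> x; rewrite /vosc/=; apply: homtrigD => //.
  by apply: (@homtrig_widen R 0); exists (- vmean Phi x).
move=> x; have iP := integrable_homtrig (hPhi x).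
have ic : la.-integrable I01 (EFin \o cst (vmean Phi x)).
  by apply: (@integrable_homtrig R 0); exists (vmean Phi x).
split.
  by apply: (integrableB _ iP ic).
under eq_integral do rewrite /vosc/= EFinB.
rewrite integralB// integral_cst// [X in (_ - _ * X)%E]lebesgue_I01 mule1.
rewrite /vmean /Rintegral fineK ?subee//; exact: integrable_fin_num.
Qed.

Lemma Leb_iter n (S : set (R * R)) : measurable (S : set T2) -> periodic_set S ->
  Leb [set z | S (iter n f z)] = Leb S.
Proof.
move=> mS pS.
have mh : measurable_fun [set: T1] (fun x : R => n%:R * x + (iter n f (0, 0)).2).
  by apply: measurable_funD => //; exact: measurable_funM.
rewrite -(Leb_skew_set (n%:R * alpha) mh mS pS); congr (Leb _).
by apply/funext => z /=; rewrite [in LHS]iter_skew addrA.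
Qed.

(** Split the Birkhoff sum of length [n + r] in both orders. The identity trades the long sum for
    the short one, which is fixed as [n] grows. *)
Lemma birkhoff_commute (phi : R * R -> R) n r z :
  birkhoff_sum f phi n (iter r f z) - birkhoff_sum f phi n z =
  birkhoff_sum f phi r (iter n f z) - birkhoff_sum f phi r z.
Proof.
have := birkhoffD alpha beta phi r n z; rewrite addnC birkhoffD => H.
lra.
Qed.

Lemma cesaro_of_not_vanishing d phi (C e : R) : admissible d phi -> 0 < C -> 0 < e ->
  (forall N, exists2 n, (N <= n)%N &
    ~ (Leb [set z | (`|birkhoff_sum f phi n z| < C)%R] <= e%:E)%E) ->
  exists K c : R, [/\ 0 < K, 0 < c & forall M, ((c * M%:R)%:E <=
    \sum_(0 <= r < M) Leb [set z | (`|birkhoff_sum f phi r z| < K / 2)%R])%E].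
Proof.
move=> aphi C0 e0 H; have e2 : 0 < e ^+ 2 / 2 by rewrite divr_gt0// exprn_gt0.
have C2 : 0 < 2 * C by rewrite mulr_gt0.
have [A HA] := decoupling alpha beta d e2 C2.
(* The maximum with 1 guarantees [0 < K], as [decoupling] says nothing about the sign of [A]. *)
pose K := 2 * Num.max A 1.
have AK : A <= K / 2 by rewrite /K mulrAC divff// mul1r le_max lexx.
have K0 : 0 < K by rewrite mulr_gt0// lt_max ltr01 orbT.
(* The second moment gives e^2 M^2 <= M (M e^2 / 2 + 2 S) with S the sum of the [p r]: decoupling
   takes half of e^2, and the double count of distances halves the rest. *)
exists K, (e ^+ 2 / 4); split=> // [|M]; first by rewrite divr_gt0// exprn_gt0.
pose S n C' := [set z | `|birkhoff_sum f phi n z| < C'].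
pose Q n r := [set z | `|birkhoff_sum f phi r (iter n f z) - birkhoff_sum f phi r z| < 2 * C].
have adm n := admissible_birkhoff alpha beta n aphi.
have mbs n : measurable_fun [set: T2] (birkhoff_sum f phi n).
  by have [cn _ _ _] := adm n; exact: continuous_measurable_pair.
have mS n C' : measurable (S n C' : set T2) by exact: measurable_lt.
have pS n C' : periodic_set (S n C').
  by move=> x y; have [_ pn _ _] := adm n; rewrite /S/=; have [-> ->] := pn x y.
have pQ n r : periodic_set (Q n r).
  move=> x y; have [_ pr _ _] := adm r; have [_ pi _ _] := admissible_iter alpha beta n (adm r).
  by rewrite /Q/=; have [-> ->] := pi x y; have [-> ->] := pr x y.
have mQ n r : measurable (Q n r : set T2).
  apply: measurable_lt; apply: measurable_funB => //.
  exact: (measurableT_comp (mbs r) (measurable_iter alpha beta n)).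
pose p r := fine (Leb (S r (K / 2))).
have p0 r : 0 <= p r by exact: fine_ge0.
have near_all : \forall n \near \oo, forall r, (r < M)%N ->
    (Leb (Q n r) <= (e ^+ 2 / 2 + p r)%:E)%E.
  have base r : \forall n \near \oo, (Leb (Q n r) <= (e ^+ 2 / 2 + p r)%:E)%E.
    apply: filterS (HA _ (adm r)) => n /le_trans; apply.
    rewrite EFinD leeD2l// /p fineK; last exact: Leb_fin.
    apply: le_measure; rewrite ?inE//; first exact: (mS r A).
    by move=> z /=; rewrite /S/= => /lt_le_trans; apply.
  elim: M => [|M IH]; first by apply: nearW.
  apply: filterS2 IH (base M) => n IH hM r; rewrite ltnS leq_eqVlt => /orP[/eqP->//|].
  exact: IH.
(* Only the finitely many [r < M] are involved, so a single bad [n] is large enough for all of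
   them. *)
have [N _ HN] := near_all; have [n Nn Hn] := H N.
have {}HN := HN n Nn.
pose B m := [set z | S n C (iter m f z)].
have mB m : measurable (B m : set T2).
  by have := measurable_iter alpha beta m measurableT (mS n C); rewrite setTI.
have LB m : (e%:E <= Leb (B m))%E.
  by rewrite Leb_iter//; apply/ltW; rewrite ltNge; apply/negP.
have sub m r : B m `&` B (m + r)%N `<=` [set z | Q n r (iter m f z)].
  move=> z [/= Bm Br]; rewrite /Q/= -birkhoff_commute -iterD addnC.
  by apply: le_lt_trans (ler_normB _ _) _; move: Bm Br; rewrite /B/S/=; lra.
have inter m r : (r < M)%N -> fine (Leb (B m `&` B (m + r)%N)) <= e ^+ 2 / 2 + p r.
  move=> rM; rewrite -lee_fin fineK; last by apply: Leb_fin; exact: measurableI.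
  apply: le_trans (HN r rM); rewrite -(Leb_iter m (mQ n r) (pQ n r)).
  have mQi : measurable ([set z | Q n r (iter m f z)] : set T2).
    by have := measurable_iter alpha beta m measurableT (mQ n r); rewrite setTI.
  have mBB : measurable (B m `&` B (m + r)%N : set T2) by exact: measurableI.
  by apply: le_measure; [rewrite inE|rewrite inE|move=> z; exact: sub].
have inter' m k : (m < M)%N -> (k < M)%N ->
    fine (Leb (B m `&` B k)) <= e ^+ 2 / 2 + p ((m - k) + (k - m))%N.
  move=> mM kM; have [mk|km] := leqP m k.
    rewrite (eqP (_ : (m - k == 0)%N))// add0n -[in B k](subnKC mk).
    by apply: inter; apply: leq_ltn_trans kM; exact: leq_subr.
  rewrite (eqP (_ : (k - m == 0)%N)) ?subn_eq0 1?ltnW// addn0 setIC -[in B m](subnKC (ltnW km)).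
  by apply: inter; apply: leq_ltn_trans mM; exact: leq_subr.
have sm := second_moment M mB (ltW e0) LB.
have up : \sum_(0 <= m < M) \sum_(0 <= k < M) fine (Leb (B m `&` B k)) <=
    M%:R * (M%:R * (e ^+ 2 / 2) + 2 * \sum_(0 <= r < M) p r).
  rewrite [leRHS]mulr_natl -[in leRHS](subn0 M) -sumr_const_nat subn0.
  rewrite big_nat [leRHS]big_nat; apply: ler_sum => m /andP[_ mM].
  apply: le_trans (lerD (lexx _) (sum_dist_le p0 mM)).
  have -> : M%:R * (e ^+ 2 / 2) = \sum_(0 <= k < M) (e ^+ 2 / 2).
    by rewrite sumr_const_nat subn0 mulr_natl.
  rewrite -big_split/= big_nat [leRHS]big_nat; apply: ler_sum => k /andP[_ kM].
  exact: inter'.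
have -> : (\sum_(0 <= r < M) Leb (S r (K / 2)%R) = (\sum_(0 <= r < M) p r)%:E)%E.
  by rewrite -sumEFin; apply: eq_bigr => r _; rewrite /p fineK// Leb_fin.
rewrite lee_fin; have [->|M0] := posnP M; first by rewrite mulr0 big_geq.
have MR : 0 < M%:R :> R by rewrite ltr0n.
have := le_trans sm up; move: (M%:R) MR (\sum_(0 <= r < M) p r) => x x0 s.
rewrite exprMn [X in _ * X]expr2 mulrA [leLHS]mulrC (ler_pM2l x0); lra.
Qed.

End Main.

Unset Implicit Arguments.

Theorem theorem6 (R : realType) (alpha beta : R) (Phi : R * R -> R) :
  irrational alpha ->
  class_M (skew_shift alpha beta) Phi ->
  forall C : R, 1 < C ->
    Leb [set z | `|birkhoff_sum (skew_shift alpha beta) (vosc Phi) n z| < C]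
      @[n --> \oo] --> 0%E.
Proof.
move=> ialpha [cR ncob] C C1.
have [d aphi] := admissible_vosc cR.
have [cphi pphi _ _] := aphi.
have C0 : 0 < C by exact: lt_trans C1.
apply: ge0_cvg0 => // e e0; apply: contrapT => nnear; apply: ncob.
have [|K [c [K0 c0 cesaro]]] := cesaro_of_not_vanishing (alpha := alpha) (beta := beta) aphi C0 e0.
  move=> N; apply: contrapT => nex; apply: nnear; exists N => // n /= Nn.
  by apply: contrapT => nle; apply: nex; exists n.
exact: (coboundary_of_cesaro (continuous_measurable_pair cphi) pphi K0 ialpha c0 cesaro).
Qed.
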